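(* Let $\mathfrak X,\mathfrak Y$ be Polish spaces, let $\mu,\nu$ be probability measures on $\mathfrak X,\mathfrak Y$ respectively, and suppose that $c\in\mathcal C(\mu,\nu)$ is lower semi-continuous. Then there exists a minimizer of $\pi\mapsto\iint c(x,y,x',y')\,\mathrm d\pi(x,y)\,\mathrm d\pi(x',y')$ over $\pi\in\Pi(\mu,\nu)$. In particular, if $\mu$ is atomless, $c$ is continuous, and $\mathfrak X,\mathfrak Y$ are compact, then $$\min_{\pi\in\Pi(\mu,\nu)}\iint c\,\mathrm d\pi\otimes\mathrm d\pi=\inf_{T\in\mathcal T(\mu,\nu)}\iint c(x,T(x),x',T(x'))\,\mathrm d\mu(x)\,\mathrm d\mu(x').$$
   Context: $\Pi(\mu,\nu)$ is the set of all probability measures on $\mathfrak X\times\mathfrak Y$ with marginals $\mu$ and $\nu$, and $\iint c\,\mathrm d\pi\otimes\mathrm d\pi=\iint c(x,y,x',y')\,\mathrm d\pi(x,y)\,\mathrm d\pi(x',y')$. $\mathcal T(\mu,\nu)$ is the set of measurable maps $T:\mathfrak X\to\mathfrak Y$ with $\mu\circ T^{-1}=\nu$. $\mathcal C(\mu,\nu)$ is the set of (measurable) functions $c:(\mathfrak X\times\mathfrak Y)^2\to\mathbb R$ such that there exist $f\in L^1(\mu\otimes\mu)$ and $g\in L^1(\nu\otimes\nu)$ with $c(x,y,x',y')\ge f(x,x')+g(y,y')$ everywhere; for such $c$ the transport cost is well-defined with values in $(-\infty,\infty]$. *)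

(* Defs.v *)
(* MathComp-Analysis; the cost is a function of pairs ((x, y), (x', y')). *)
From HB Require Import structures.
From mathcomp Require Import all_boot all_order all_algebra.
From mathcomp Require Import all_classical all_reals all_analysis.

Set Implicit Arguments.
Unset Strict Implicit.
Unset Printing Implicit Defensive.

Import Order.TTheory GRing.Theory Num.Theory.
Import numFieldNormedType.Exports.

Local Open Scope classical_set_scope.
Local Open Scope ring_scope.
Local Open Scope ereal_scope.

Definition separable (T : topologicalType) : Prop :=
  exists2 D : set T, countable D & dense D.

(* [dist] is a metric (nonnegativity follows from the other axioms) which
   induces the topology of [T] and for which Cauchy sequences converge. *)
Definition complete_compatible_metric (R : realType) (T : topologicalType)
    (dist : T -> T -> R) : Prop :=
  [/\ (forall x y, dist x y = 0%R <-> x = y),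
      (forall x y, dist x y = dist y x),
      (forall x y z, (dist x z <= dist x y + dist y z)%R),
      (forall x, nbhs x = filter_from [set e : R | (0 < e)%R]
                            (fun e => [set y | (dist x y < e)%R])) &
      (forall u : nat -> T,
         (forall e : R, (0 < e)%R ->
            exists N, forall i j, (N <= i)%N -> (N <= j)%N ->
              (dist (u i) (u j) < e)%R) ->
         exists l : T, u @ \oo --> l)].

Definition polish (R : realType) (T : topologicalType) : Prop :=
  separable T /\ exists dist : T -> T -> R, complete_compatible_metric dist.

(* A copy of [T] carrying the Borel sigma-algebra. MathComp-Analysis asks
   measurable types to be pointed, hence [ptopologicalType]; a space carrying a
   probability measure is nonempty anyway. *)
Definition borel (T : ptopologicalType) :
    measurableType (sigma_display (@open T)) :=
  [the measurableType _ of g_sigma_algebraType (@open T)].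

Section transport.
Context {dX dY : measure_display} {X : measurableType dX}
  {Y : measurableType dY} {R : realType}.

Definition atomless (mu : probability X R) : Prop :=
  ~ exists A : set X, [/\ measurable A, 0 < mu A &
      forall B : set X, measurable B -> B `<=` A -> mu B = 0 \/ mu B = mu A].

(* Measures are functions on all sets, so equality of measures is only required
   on measurable sets. *)
Definition couplings (mu : probability X R) (nu : probability Y R) :
    set (probability (X * Y)%type R) :=
  [set pi | (forall A : set X, measurable A -> pushforward pi fst A = mu A) /\
            (forall B : set Y, measurable B -> pushforward pi snd B = nu B)].

Definition transport_maps (mu : probability X R) (nu : probability Y R) :
    set (X -> Y) :=
  [set T | measurable_fun [set: X] T /\
           (forall B : set Y, measurable B -> pushforward mu T B = nu B)].

Definition cost_class (mu : probability X R) (nu : probability Y R) :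
    set ((X * Y) * (X * Y) -> R) :=
  [set c | measurable_fun [set: (X * Y) * (X * Y)] c /\
     exists (f : X * X -> R) (g : Y * Y -> R),
       [/\ (mu \x mu).-integrable [set: X * X] (EFin \o f),
           (nu \x nu).-integrable [set: Y * Y] (EFin \o g) &
           forall x y x' y',
             (f (x, x') + g (y, y') <= c ((x, y), (x', y')))%R]].

(* The library integral is the integral of the positive part minus that of the
   negative part; the latter is finite when [c] is in [cost_class mu nu] and
   [pi] (resp. [T]) is a coupling of (resp. transports) [mu] and [nu]. *)
Definition plan_cost (pi : probability (X * Y)%type R)
    (c : (X * Y) * (X * Y) -> R) : \bar R :=
  \int[pi \x pi]_z (c z)%:E.

Definition map_cost (mu : probability X R) (c : (X * Y) * (X * Y) -> R)
    (T : X -> Y) : \bar R :=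
  \int[mu \x mu]_z (c ((z.1, T z.1), (z.2, T z.2)))%:E.

Definition minimizer (mu : probability X R) (nu : probability Y R)
    (c : (X * Y) * (X * Y) -> R) (pi : probability (X * Y)%type R) : Prop :=
  couplings mu nu pi /\
  forall pi', couplings mu nu pi' -> plan_cost pi c <= plan_cost pi' c.

End transport.

(* Main.v *)
Require Import Defs.
From HB Require Import structures.
From mathcomp Require Import all_boot all_order all_algebra.
From mathcomp Require Import all_classical all_reals all_analysis.
From mathcomp Require Import measurable_realfun.
From mathcomp Require Import ring lra.
Import Order.TTheory GRing.Theory Num.Theory.
Import numFieldNormedType.Exports.

Set Implicit Arguments.
Unset Strict Implicit.
Unset Printing Implicit Defensive.

Local Open Scope classical_set_scope.
Local Open Scope ring_scope.

(** Existence of a minimizer. The couplings of [mu] and [nu] are compact for a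
topology much finer than the weak one, that of convergence on all measurable
rectangles [A `*` B]. Along an ultrafilter every bounded function converges, so
the masses of all sets converge to a finitely additive set function
([limit_mass_content]). Its marginals are still [mu] and [nu], which on Polish
spaces are inner regular for compact sets and outer regular for open ones. By
the usual finite-subcover argument this alone makes it countably subadditive on
rectangles ([limit_sigma_subadditive]), and Caratheodory's theorem turns it into
a coupling ([plan_of_content]).

The cost is lower semicontinuous for this topology ([plan_cost_lsc]). The square
of a coupling is itself a coupling of [mu \x mu] and [nu \x nu], so convergence
passes to the sets [join_rect F G] with [F] in [X * X] and [G] in [Y * Y]
measurable, because the fixed marginals forbid any loss of countable additivity
in one variable ([content_unique], [limit_square_join]). A function of [(x, x')]
plus a function of [(y, y')] therefore needs no regularity: the superlevel sets
of [c - f - g] are countable unions of sets [join_rect F G], as those of [c] are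
open and the spaces have countable bases ([excess_superlevel]). On a countable
union the limit can only gain mass ([le_content_bigcup]), and a staircase
approximation carries this over to the integral of [c - f - g]
([integral_limit_mass_gt]), whereas [f + g] has the same integral for all
couplings ([plan_cost_excess]). An ultrafilter of better and better couplings
hence has a minimizer as its limit ([exists_minimizer]).

Transport maps. A transport map yields the coupling carried by its graph, with
the same cost, so the minimum is at most the infimum. Conversely [- c] is bounded
and lower semicontinuous as well, so the same lemma shows that the cost is upper
semicontinuous, and it is enough to find transport maps whose graphs converge to
the minimizer [pi] on all rectangles ([approximate_cost]). Cut [X] into finer and
finer finite partitions that generate the Borel sets; on each cell [A] of the
[n]-th partition choose a map that pushes [mu] restricted to [A] to the measure
[B |-> pi (A `*` B)] ([approximating_map]). The rectangles above the cells then
have eventually the right mass, and [content_unique] gives all the others. The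
maps on the cells exist because an atomless measure can be divided in any
proportion ([atomless_split]), so that it imitates a nested sequence of partitions
of the compact space [Y] into small cells ([transport_onto]). *)

(** * Metric spaces *)

Section mesh.
Context {R : realType}.

Definition mesh (n : nat) : R := n.+1%:R^-1.

Lemma mesh_gt0 n : 0 < mesh n.
Proof. by rewrite invr_gt0 ltr0n. Qed.

Lemma mesh_lt (e : R) : 0 < e -> exists n : nat, mesh n < e.
Proof.
move=> e0; have [n _ h] := near_infty_natSinv_lt (PosNum e0).
by exists n; apply: (h n) => /=.
Qed.

Lemma mesh_le n m : (n <= m)%N -> mesh m <= mesh n.
Proof. by move=> nm; rewrite lef_pV2 ?posrE ?ltr0n// ler_nat. Qed.

End mesh.

Section metric_topology.
Context {R : realType} {T : topologicalType} {dist : T -> T -> R}.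
Hypothesis hd : complete_compatible_metric dist.

Definition oball (x : T) (e : R) : set T := [set y | dist x y < e].

Let distxx x : dist x x = 0.
Proof. by case: hd => h _ _ _ _; apply/h. Qed.

Let distC x y : dist x y = dist y x.
Proof. by case: hd. Qed.

Let dist_tri y x z : dist x z <= dist x y + dist y z.
Proof. by case: hd. Qed.

Lemma nbhs_dist x (A : set T) :
  nbhs x A <-> exists2 e : R, 0 < e & oball x e `<=` A.
Proof. by case: hd => _ _ _ -> _. Qed.

Lemma open_dist (A : set T) :
  (forall x, A x -> exists2 e : R, 0 < e & oball x e `<=` A) -> open A.
Proof. by rewrite openE => h x Ax; apply/nbhs_dist; exact: h. Qed.

Lemma dist_open (A : set T) x : open A -> A x ->
  exists2 e : R, 0 < e & oball x e `<=` A.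
Proof. by rewrite openE => oA Ax; apply/nbhs_dist; exact: oA. Qed.

Lemma open_oball x e : open (oball x e).
Proof.
apply: open_dist => y xy; exists (e - dist x y); first by rewrite subr_gt0.
move=> z; rewrite /oball /= => yz; have := dist_tri y x z; lra.
Qed.

Lemma closed_cball x e : closed [set y | dist x y <= e].
Proof.
rewrite -openC; apply: open_dist => y /=/negP; rewrite -ltNge => xy.
exists (dist x y - e); first by rewrite subr_gt0.
move=> z; rewrite /oball /= => yz; apply/negP; rewrite -ltNge.
have := dist_tri z x y; rewrite (distC z y); lra.
Qed.

Definition thicken (A : set T) (e : R) : set T :=
  [set y | exists2 z, A z & dist z y < e].

Lemma open_thicken A e : open (thicken A e).
Proof.
rewrite (_ : thicken A e = \bigcup_(z in A) oball z e).
  by apply: bigcup_open => z _; exact: open_oball.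
by apply/seteqP; split=> y [z Az zy]; exists z.
Qed.

Lemma bigcap_thicken C : closed C -> \bigcap_n thicken C (mesh n) = C.
Proof.
move=> cC; apply/seteqP; split=> [y hy|y Cy n _]; last first.
  by exists y => //; rewrite distxx mesh_gt0.
apply: contrapT => nCy; have [|e e0 he] := @dist_open (~` C) y _ nCy.
  exact: closed_openC.
have [n ne] := mesh_lt e0; have [z Cz zy] := hy n I.
by apply: (he z) => //; rewrite /oball /= distC; exact: lt_trans ne.
Qed.

Lemma thicken_mono A e e' : e <= e' -> thicken A e `<=` thicken A e'.
Proof. by move=> ee y [z Az zy]; exists z => //; exact: lt_le_trans ee. Qed.

(** An ultrafilter on [K] contains one of finitely many balls of each radius. The
centers of these balls form a Cauchy sequence, as any two of the balls meet, and
its limit is the limit of the ultrafilter. *)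
Lemma compact_totally_bounded (K : set T) : closed K ->
  (forall e, 0 < e -> exists (s : nat -> T) n,
     K `<=` \bigcup_(i < n) [set y | dist (s i) y <= e]) ->
  compact K.
Proof.
move=> cK tb; rewrite compact_ultra => F FU FK.
have pick e : 0 < e -> exists x, F [set y | dist x y <= e].
  move=> e0; have [s [n Ks]] := tb e e0.
  apply: contrapT => hF.
  suff : forall m, F (K `&` ~` \bigcup_(i < m) [set y | dist (s i) y <= e]).
    by move=> /(_ n) /filter_ex [y [/Ks]].
  elim=> [|m IH].
    by apply: filterS FK => y Ky; split => // -[i /=].
  have Fm : F (~` [set y | dist (s m) y <= e]).
    case: (in_ultra_setVsetC [set y | dist (s m) y <= e] FU) => // h.
    by exfalso; apply: hF; exists (s m).
  apply: filterS (filterI IH Fm) => y [[Ky ny] nm]; split => // -[i /=].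
  by rewrite ltnS leq_eqVlt => /predU1P[->//|im ?]; apply: ny; exists i.
have [u hu] := choice (fun n => pick _ (mesh_gt0 n)).
have meet n m : dist (u n) (u m) <= mesh n + mesh m.
  have [z [/= h1 h2]] : ([set y | dist (u n) y <= mesh n] `&`
      [set y | dist (u m) y <= mesh m]) !=set0.
    by apply: (@filter_ex _ F); exact: filterI.
  have := dist_tri z (u n) (u m); rewrite (distC z (u m)); lra.
have [l ul] : exists l : T, u @ \oo --> l.
  have [_ _ _ _] := hd; apply => e e0.
  have [N hN] := mesh_lt (divr_gt0 e0 (ltr0n R 2)).
  exists N => i j Ni Nj; have := meet i j.
  have := @mesh_le R _ _ Ni; have := @mesh_le R _ _ Nj; lra.
have Fl : F --> l.
  move=> A /nbhs_dist[e e0 eA].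
  have e30 : 0 < e / 3 by lra.
  have /ul : nbhs l (oball l (e / 3)) by apply/nbhs_dist; exists (e / 3).
  case=> N1 _ hN1; have [N2 hN2] := mesh_lt e30.
  pose N := maxn N1 N2.
  have := hN1 N (leq_maxl _ _); rewrite /oball /= => lN.
  apply: filterS (hu N) => y /= Ny; apply: eA; rewrite /oball /=.
  have := dist_tri (u N) l y; have := @mesh_le R N2 N (leq_maxr _ _); lra.
exists l; split => //; rewrite [K]((closure_id K).1 cK).
move=> B /Fl FB; by apply: (@filter_ex _ F); exact: filterI.
Qed.

End metric_topology.

Lemma separable_seq (T : ptopologicalType) : separable T ->
  exists d : nat -> T, forall O : set T, O !=set0 -> open O -> exists n, O (d n).
Proof.
case=> D /countable_injP[f injf] denseD.
exists (fun n => xget point (D `&` [set x | f x = n])) => O O0 oO.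
have [x [Ox Dx]] := denseD O O0 oO.
exists (f x); case: xgetP => [y _ [Dy fxy]|/(_ x)]; last by case.
by rewrite (_ : y = x)//; apply: injf; rewrite ?inE.
Qed.

Section balls.
Context {R : realType} {T : ptopologicalType} {dist : T -> T -> R}.
Hypothesis hd : complete_compatible_metric dist.

(** A single sequence that runs through the balls of radius [mesh k] around the
points of a sequence [d]. *)
Definition ball_seq (d : nat -> T) (n : nat) : set T :=
  if unpickle n is Some (j, k) then oball (dist := dist) (d j) (mesh k) else set0.

Lemma ball_seq_open d n : open (ball_seq d n).
Proof.
rewrite /ball_seq; case: unpickle => [[j k]|]; last exact: open0.
exact: open_oball.
Qed.

Variable d : nat -> T.
Hypothesis d_dense :
  forall O : set T, O !=set0 -> open O -> exists n, O (d n).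

Lemma ball_seq_base (O : set T) x : open O -> O x ->
  exists2 n, ball_seq d n x & ball_seq d n `<=` O.
Proof.
move=> oO Ox; have [e e0 eO] := dist_open hd oO Ox.
have [k hk] := mesh_lt (divr_gt0 e0 (ltr0n R 2)).
have [||j xj] := d_dense (O := oball (dist := dist) x (mesh k)).
- exists x; rewrite /oball /=; case: hd => h _ _ _ _.
  by rewrite (h x x).2 ?mesh_gt0.
- exact: open_oball.
case: (hd) => _ dC tri _ _.
exists (pickle (j, k)); rewrite /ball_seq pickleK /oball /=.
  by rewrite dC.
move=> y /= dy; apply: eO; move: xj; rewrite /oball /= => xj.
have := tri x (d j) y; lra.
Qed.

Lemma cover_balls (k : nat) x : exists j, dist (d j) x < mesh k.
Proof.
have [||j xj] := d_dense (O := oball (dist := dist) x (mesh k)).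
- exists x; rewrite /oball /=; case: hd => h _ _ _ _.
  by rewrite (h x x).2 ?mesh_gt0.
- exact: open_oball.
by exists j; case: hd => _ -> _ _ _.
Qed.

End balls.

(** * Contents, finite measures and their regularity *)

Lemma preimage_measurable {d d' : measure_display} {Z : measurableType d}
    {W : measurableType d'} (f : Z -> W) (A : set W) :
  measurable_fun setT f -> measurable A -> measurable (f @^-1` A).
Proof. by move=> mf mA; rewrite -[X in measurable X]setTI; exact: mf. Qed.

Section content.
Context {d : measure_display} {Z : measurableType d} {R : realType}.
Implicit Types (L : set Z -> R) (A B : set Z).

Definition finitely_additive L : Prop :=
  (forall A, measurable A -> 0 <= L A) /\
  forall A B, measurable A -> measurable B -> A `&` B = set0 ->
    L (A `|` B) = L A + L B.

Section one_content.
Variable L : set Z -> R.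
Hypothesis hL : finitely_additive L.

Lemma content0 : L set0 = 0.
Proof.
have := hL.2 set0 set0 measurable0 measurable0 (setI0 _).
by rewrite setU0; lra.
Qed.

Lemma contentDI A B : measurable A -> measurable B ->
  L (A `\` B) = L A - L (A `&` B).
Proof.
move=> mA mB; have mI := measurableI _ _ mA mB; have mD := measurableD mA mB.
have -> : L A = L (A `&` B) + L (A `\` B); last by ring.
by rewrite -hL.2// ?setUIDK// setDE setIACA setICr setI0.
Qed.

Lemma contentD A B : measurable A -> measurable B -> B `<=` A ->
  L (A `\` B) = L A - L B.
Proof. by move=> mA mB BA; rewrite contentDI// setIidr. Qed.

Lemma le_content A B : measurable A -> measurable B -> A `<=` B -> L A <= L B.
Proof.
move=> mA mB AB; rewrite -subr_ge0 -contentD//; apply: hL.1.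
exact: measurableD.
Qed.

Lemma contentUI A B : measurable A -> measurable B ->
  L (A `|` B) = L A + L B - L (A `&` B).
Proof.
move=> mA mB; have mU := measurableU _ _ mA mB.
have : L ((A `|` B) `\` A) = L (A `|` B) - L A by rewrite contentD.
by rewrite setDUl setDv set0U contentDI// (setIC B A); lra.
Qed.

Lemma contentU_le A B : measurable A -> measurable B ->
  L (A `|` B) <= L A + L B.
Proof.
move=> mA mB; rewrite contentUI//.
by have := hL.1 _ (measurableI _ _ mA mB); lra.
Qed.

Lemma content_bigsetU_le (A : nat -> set Z) n : (forall i, measurable (A i)) ->
  L (\big[setU/set0]_(i < n) A i) <= \sum_(i < n) L (A i).
Proof.
move=> mA; elim: n => [|n IH]; first by rewrite !big_ord0 content0.
rewrite !big_ord_recr/=; apply: le_trans (lerD IH (lexx _)).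
by apply: contentU_le => //; apply: bigsetU_measurable.
Qed.

End one_content.

(** By inclusion-exclusion, one set at a time. *)
Lemma eq_content_bigsetU L L' (Q : set (set Z)) :
  finitely_additive L -> finitely_additive L' ->
  Q `<=` measurable -> setI_closed Q -> (forall A, Q A -> L A = L' A) ->
  forall (A : nat -> set Z) n, (forall i, Q (A i)) ->
  L (\big[setU/set0]_(i < n) A i) = L' (\big[setU/set0]_(i < n) A i).
Proof.
move=> hL hL' mQ IQ LL' A n; elim: n A => [|n IH] A QA.
  by rewrite !big_ord0 !content0.
rewrite !big_ord_recr/= !contentUI//; try exact: mQ.
- have QI i : Q (A i `&` A n) by exact: IQ.
  by rewrite big_distrl/= IH// (IH _ QI) LL'.
- by apply: bigsetU_measurable => i _; exact: mQ.
- by apply: bigsetU_measurable => i _; exact: mQ.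
Qed.

End content.

Section mass.
Context {d : measure_display} {Z : measurableType d} {R : realType}.

Definition mass (m : set Z -> \bar R) (A : set Z) : R := fine (m A).

Variable m : {finite_measure set Z -> \bar R}.
Implicit Types A B : set Z.

Lemma massE A : measurable A -> m A = (mass m A)%:E.
Proof. by move=> mA; rewrite /mass fineK// fin_num_measure. Qed.

Lemma mass_content : finitely_additive (mass m).
Proof.
split=> [A _|A B mA mB AB0]; first by rewrite /mass fine_ge0.
apply: EFin_inj.
by rewrite EFinD -!massE ?measureU//; exact: measurableU.
Qed.

Lemma mass0 : mass m set0 = 0.
Proof. exact: content0 mass_content. Qed.

Lemma le_mass A B : measurable A -> measurable B -> A `<=` B ->
  mass m A <= mass m B.
Proof. exact: le_content mass_content A B. Qed.

Lemma massU_le A B : measurable A -> measurable B ->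
  mass m (A `|` B) <= mass m A + mass m B.
Proof. exact: contentU_le mass_content A B. Qed.

Lemma mass_bigcup_small (A : nat -> set Z) (e : R) : 0 <= e ->
  (forall n, measurable (A n)) ->
  (forall n, mass m (A n) <= e / (2 ^ n.+1)%:R) -> mass m (\bigcup_n A n) <= e.
Proof.
move=> e0 mA Ae; rewrite -lee_fin -massE; last exact: bigcupT_measurable.
apply: (@le_trans _ _ (\sum_(i <oo) m (A i))%E).
  by apply: measure_sigma_subadditive => //; exact: bigcupT_measurable.
apply: le_trans (epsilon_trick0 xpredT e0).
by apply: lee_nneseries => // n _; rewrite massE// lee_fin.
Qed.

Lemma cvg_mass_bigcup (A : nat -> set Z) : (forall n, measurable (A n)) ->
  nondecreasing_seq A -> mass m (A n) @[n --> \oo] --> mass m (\bigcup_n A n).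
Proof.
move=> mA ndA; apply: fine_cvg; rewrite -massE; last exact: bigcupT_measurable.
by apply: nondecreasing_cvg_mu => //; exact: bigcupT_measurable.
Qed.

Lemma cvg_mass_bigcap (A : nat -> set Z) : (forall n, measurable (A n)) ->
  nonincreasing_seq A -> mass m (A n) @[n --> \oo] --> mass m (\bigcap_n A n).
Proof.
move=> mA niA; apply: fine_cvg; rewrite -massE; last exact: bigcapT_measurable.
apply: nonincreasing_cvg_mu => //; last exact: bigcapT_measurable.
by rewrite -ge0_fin_numE// fin_num_measure.
Qed.

Lemma mass_bigcap_lt (A : nat -> set Z) (e : R) : (forall n, measurable (A n)) ->
  nonincreasing_seq A -> mass m (\bigcap_n A n) < e -> exists n, mass m (A n) < e.
Proof.
move=> mA niA lt_e; have := cvg_mass_bigcap mA niA.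
move=> /cvgr_lt /(_ _ lt_e) [n _ hn]; exists n; exact: (hn n (leqnn n)).
Qed.

Lemma mass_bigcup_gt (A : nat -> set Z) (e : R) : (forall n, measurable (A n)) ->
  nondecreasing_seq A -> e < mass m (\bigcup_n A n) -> exists n, e < mass m (A n).
Proof.
move=> mA niA lt_e; have := cvg_mass_bigcup mA niA.
move=> /cvgr_gt /(_ _ lt_e) [n _ hn]; exists n; exact: (hn n (leqnn n)).
Qed.

(** The remainders decrease to the empty set. *)
Lemma mass_remainder (A : nat -> set Z) (e : R) : 0 < e ->
  (forall n, measurable (A n)) ->
  exists n, mass m (\bigcup_i A i `\` \bigcup_(i < n) A i) < e.
Proof.
move=> e0 mA; apply: mass_bigcap_lt.
- move=> n; apply: measurableD; first exact: bigcupT_measurable.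
  by apply: bigcup_measurable.
- move=> n k nk; apply/subsetPset; apply: setDS => x [i /= ik Aix].
  by exists i => //=; exact: leq_trans nk.
- rewrite (_ : \bigcap_n _ = set0) ?mass0//.
  rewrite -subset0 => x hx; have [[i _ Aix] _] := hx 0 I.
  by have [_] := hx i.+1 I; case; exists i => /=.
Qed.

End mass.

Section regularity.
Context {R : realType} {T : ptopologicalType} {dist : T -> T -> R}.
Hypothesis hd : complete_compatible_metric dist.
Variable m : {finite_measure set (borel T) -> \bar R}.

Lemma open_borel (A : set T) : open A -> measurable (A : set (borel T)).
Proof. by move=> oA; exact: sub_sigma_algebra. Qed.

Lemma closed_borel (A : set T) : closed A -> measurable (A : set (borel T)).
Proof.
move=> cA; rewrite -(setCK A); apply: measurableC; apply: open_borel.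
exact: closed_openC.
Qed.

(** The sets that can be squeezed between a closed and an open set up to small
mass form a sigma-algebra; a closed set is the intersection of its shrinking
open neighborhoods, so all Borel sets are among them. *)
Lemma squeeze_closed_open (A : set (borel T)) (e : R) : measurable A -> 0 < e ->
  exists (C O : set T), [/\ closed C, open O, C `<=` A, A `<=` O
    & mass m ((O : set (borel T)) `\` C) < e].
Proof.
move=> mA; move: A mA e.
pose P := [set A : set T | forall e : R, 0 < e -> exists (C O : set T),
  [/\ closed C, open O, C `<=` A, A `<=` O
    & mass m ((O : set (borel T)) `\` C) < e]].
suff : <<s open >> `<=` P by move=> h A mA e e0; exact: h.
have PC A : P A -> P (~` A).
  move=> PA e e0; have [C [ O [cC oO CA AO me]]] := PA e e0.
  exists (~` O), (~` C); split; [exact: open_closedC|exact: closed_openC| | |].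
  - exact: subsetC.
  - exact: subsetC.
  - by rewrite setDE setCK setIC -setDE.
apply: smallest_sub; first split.
- move=> e e0; exists set0, set0.
  by split => //; [exact: closed0|exact: open0|rewrite setD0 mass0].
- by move=> A PA; rewrite setTD; exact: PC.
- move=> A PA e e0.
  have e20 : 0 < e / 2 by lra.
  have e2n n : 0 < e / 2 / (2 ^ n.+1)%:R.
    by apply: divr_gt0 => //; rewrite ltr0n expn_gt0.
  have [C hC] := choice (fun n => PA n _ (e2n n)).
  have [ O_ hO] := choice hC.
  have mO n : measurable (O_ n : set (borel T)).
    by apply: open_borel; case: (hO n).
  have mC n : measurable (C n : set (borel T)).
    by apply: closed_borel; case: (hO n).
  have [n hn] := mass_remainder m e20 mC.
  exists (\bigcup_(i < n) C i), (\bigcup_i O_ i).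
  have cU : closed (\bigcup_(i < n) C i).
    by apply: closed_bigcup => [|i _]; [exact: finite_II|case: (hO i)].
  have oU : open (\bigcup_i O_ i) by apply: bigcup_open => i _; case: (hO i).
  split => //.
  - by move=> x [i _ Cx]; exists i => //; case: (hO i) => _ _ h _ _; exact: h.
  - by move=> x [i _ Ax]; exists i => //; case: (hO i) => _ _ _ h _; exact: h.
  - have mD : forall i, measurable ((O_ i : set (borel T)) `\` C i).
      by move=> i; exact: measurableD.
    have h1 : mass m (\bigcup_i ((O_ i : set (borel T)) `\` C i)) <= e / 2.
      apply: mass_bigcup_small => //; first exact: ltW.
      by move=> i; apply: ltW; case: (hO i).
    have mcU : measurable ((\bigcup_(i < n) C i) : set (borel T)).
      exact: closed_borel.
    have mU : measurable ((\bigcup_i C i) : set (borel T)).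
      exact: bigcupT_measurable.
    have mDU : measurable ((\bigcup_i (O_ i `\` C i)) : set (borel T)).
      exact: bigcupT_measurable.
    have moU := open_borel oU.
    have mDD : measurable ((\bigcup_i C i `\` \bigcup_(i < n) C i) : set (borel T)).
      exact: measurableD.
    have := massU_le m mDU mDD.
    have : mass m ((\bigcup_i O_ i : set (borel T)) `\` \bigcup_(i < n) C i) <=
      mass m (\bigcup_i ((O_ i : set (borel T)) `\` C i) `|`
              (\bigcup_i C i `\` \bigcup_(i < n) C i)).
      apply: le_mass; [exact: measurableD|exact: measurableU|].
      move=> x [[i _ Ox] nx]; have [Cx|nCx] := pselect (C i x).
        by right; split => //; exists i.
      by left; exists i.
    lra.
- move=> A oA; rewrite -(setCK A); apply: PC => e e0.
  have cA : closed (~` A) by exact: open_closedC.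
  have [|||n hn] := @mass_bigcap_lt _ _ _ m
      (fun n => thicken (dist := dist) (~` A) (mesh n) `\` ~` A) e.
  + move=> n; apply: measurableD; [apply: open_borel|exact: closed_borel].
    exact: open_thicken.
  + move=> n k nk; apply/subsetPset; apply: setSD; apply: thicken_mono.
    exact: mesh_le.
  + rewrite (_ : \bigcap_n _ = set0) ?mass0//.
    rewrite -subset0 => x hx; have [_] := hx 0 I; apply.
    by rewrite -(bigcap_thicken hd cA) => k _; case: (hx k I).
  exists (~` A), (thicken (dist := dist) (~` A) (mesh n)); split => //.
  + exact: open_thicken.
  + by rewrite -{1}(bigcap_thicken hd cA) => x /(_ n I).
Qed.

Hypothesis sepT : separable T.

(** Ulam's theorem: for each radius finitely many of the balls that cover [T] carry
all but a tiny amount of the mass, and the intersection over all radii is closed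
and totally bounded. *)
Lemma tight (e : R) : 0 < e ->
  exists2 K : set T, closed K /\ compact K & mass m (~` (K : set (borel T))) < e.
Proof.
move=> e0; have e20 : 0 < e / 2 by lra.
have [s s_dense] := separable_seq sepT.
pose B k j := [set y | dist (s j) y <= mesh k].
have cB k j : closed (B k j) by exact: closed_cball.
have e2n n : 0 < e / 2 / (2 ^ n.+1)%:R.
  by apply: divr_gt0 => //; rewrite ltr0n expn_gt0.
have hN k : exists n,
    mass m (~` (\bigcup_(j < n) B k j : set (borel T))) < e / 2 / (2 ^ k.+1)%:R.
  have [|n hn] := @mass_remainder _ _ _ m (B k) _ (e2n k).
    by move=> j; exact: closed_borel.
  exists n; apply: le_lt_trans hn; rewrite le_eqVlt; apply/orP; left; apply/eqP.
  congr (mass m _); rewrite (_ : \bigcup_i _ = setT) ?setTD//.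
  apply/seteqP; split => // x _; have [j xj] := cover_balls hd s_dense k x.
  by exists j => //; rewrite /B /=; exact: ltW.
have [N hN'] := choice hN.
pose K := \bigcap_k \bigcup_(j < N k) B k j.
have cBU k : closed (\bigcup_(j < N k) B k j).
  by apply: closed_bigcup => [|j _]; [exact: finite_II|exact: cB].
have cK : closed K by apply: closed_bigI => k _; exact: cBU.
exists K; first split => //.
  apply: (compact_totally_bounded hd cK) => r r0.
  have [k hk] := mesh_lt r0; exists s, (N k) => y /(_ k I)[j /= jN Bj].
  by exists j => //=; apply: le_trans (ltW hk).
rewrite setC_bigcap; apply: (@le_lt_trans _ _ (e / 2)); last by lra.
apply: mass_bigcup_small; first exact: ltW.
- by move=> k; apply: measurableC; exact: closed_borel.
- by move=> k; exact: ltW.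
Qed.

Lemma inner_compact (A : set (borel T)) (e : R) : measurable A -> 0 < e ->
  exists K : set T, [/\ closed K, compact K, K `<=` A
    & mass m (A `\` (K : set (borel T))) < e].
Proof.
move=> mA e0; have e20 : 0 < e / 2 by lra.
have [C [ O [cC oO CA AO hC]]] := squeeze_closed_open mA e20.
have [K [cK compK] hK] := tight e20.
have mC := closed_borel cC; have mK := closed_borel cK; have mO := open_borel oO.
have mDO := measurableD mO mC; have mKC := measurableC mK.
exists (C `&` K); split; first exact: closedI.
- by rewrite setIC; exact: compact_closedI.
- by apply: subset_trans CA; exact: subIsetl.
- have := massU_le m mDO mKC.
  have : mass m (A `\` ((C `&` K) : set (borel T))) <=
      mass m (((O : set (borel T)) `\` C) `|` ~` (K : set (borel T))).
    apply: le_mass; [|exact: measurableU|].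
      by apply: measurableD => //; exact: measurableI.
    move=> x [Ax nx]; have [Cx|nCx] := pselect (C x).
      by right => Kx; apply: nx.
    by left; split => //; exact: AO.
  lra.
Qed.

Lemma outer_open (A : set (borel T)) (e : R) : measurable A -> 0 < e ->
  exists O : set T, [/\ open O, A `<=` O & mass m ((O : set (borel T)) `\` A) < e].
Proof.
move=> mA e0; have [C [ O [cC oO CA AO hC]]] := squeeze_closed_open mA e0.
exists O; split => //; apply: le_lt_trans hC; apply: le_mass.
- by apply: measurableD => //; exact: open_borel.
- by apply: measurableD; [exact: open_borel|exact: closed_borel].
- exact: setDS.
Qed.

End regularity.

(** * Limits of measures along an ultrafilter *)

Section ultrafilter_limit.
Context {J : Type} {U : set_system J} {UU : UltraFilter U} {R : realType}.
Context {d : measure_display} {Z : measurableType d}.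
Variable m : J -> probability Z R.

Lemma ultra_cvg (f : J -> R) : (forall j, 0 <= f j <= 1) ->
  f @ U --> lim (f @ U).
Proof.
move=> f01; have /(_ (f @ U) _ _)[|l [_ fl]] := @segment_compact R 0 1.
  by apply: (@filterE _ U) => j; rewrite /= in_itv /= f01.
apply/cvg_ex; exists l => V nV.
case: (in_ultra_setVsetC (f @^-1` V) UU) => // UnV.
by have [y [/= nVy Vy]] := fl (~` V) V UnV nV.
Qed.

(** Only finitely additive in [A]. *)
Definition limit_mass (A : set Z) : R := lim (mass (m j) A @[j --> U]).

Lemma cvg_limit_mass A : measurable A ->
  mass (m j) A @[j --> U] --> limit_mass A.
Proof.
move=> mA; apply: ultra_cvg => j; rewrite (mass_content _).1//=.
by rewrite -lee_fin -massE// probability_le1.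
Qed.

Lemma limit_mass_eq A r : measurable A -> (\forall j \near U, mass (m j) A = r) ->
  limit_mass A = r.
Proof.
move=> mA h; apply: (@cvg_unique _ _ (mass (m j) A @[j --> U])) => //.
  exact: cvg_limit_mass.
by apply: cvg_near_cst.
Qed.

Lemma limit_mass_content : finitely_additive limit_mass.
Proof.
split=> [A mA|A B mA mB AB0].
  apply: (limr_ge (cvg_limit_mass mA)).
  by apply: nearW => j; exact: (mass_content _).1.
apply: cvg_lim => //.
rewrite [X in X @ _ --> _](_ : _ = fun j => mass (m j) A + mass (m j) B).
  by apply: cvgD; exact: cvg_limit_mass.
by apply/funext => j; exact: (mass_content _).2.
Qed.

End ultrafilter_limit.

Section dominated_content.
Context {R : realType} {d : measure_display} {Z : measurableType d}.
Context {d' : measure_display} {W : measurableType d'}.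

(** A finitely additive [L] behaves as a countably additive one along the preimages
of a map that pushes it to a genuine measure [lam], because the tails of a
countable union have small [lam]-mass; so Dynkin's pi-lambda argument applies to
[L]. The set [S] accounts for the other variable of a rectangle. *)
Lemma content_unique (L : set Z -> R) (g : {finite_measure set Z -> \bar R})
    (lam : {finite_measure set W -> \bar R}) (Phi : Z -> W) (S : set Z)
    (G : set (set W)) :
  finitely_additive L -> measurable_fun setT Phi ->
  (forall F, measurable F -> L (Phi @^-1` F) = mass lam F) ->
  (forall F, measurable F -> mass g (Phi @^-1` F) = mass lam F) ->
  measurable S -> @measurable _ W = <<s G >> -> setI_closed G ->
  L S = mass g S ->
  (forall F, G F -> L (Phi @^-1` F `&` S) = mass g (Phi @^-1` F `&` S)) ->
  forall F, measurable F -> L (Phi @^-1` F `&` S) = mass g (Phi @^-1` F `&` S).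
Proof.
move=> hL mPhi Llam glam mS GE IG LS LG F mF.
have mpre E : measurable E -> measurable (Phi @^-1` E).
  by move=> mE; exact: (preimage_measurable mPhi).
have mpreI E : measurable E -> measurable (Phi @^-1` E `&` S).
  by move=> mE; apply: measurableI => //; exact: mpre.
have hg := mass_content g.
pose P F := L (Phi @^-1` F `&` S) = mass g (Phi @^-1` F `&` S).
suff : P F by [].
apply: (@dynkin_induction _ _ G P GE IG) => //.
- by rewrite /P preimage_setT setTI.
- move=> E mE PE; rewrite /P preimage_setC setIC -setDE.
  by rewrite !contentDI//; try exact: mpre; rewrite setIC LS PE.
- move=> E mE tE PE; rewrite /P.
  have mU n : measurable (\bigcup_(i < n) E i) by exact: bigcup_measurable.
  have mUT : measurable (\bigcup_i E i) by exact: bigcupT_measurable.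
  have PU n : P (\bigcup_(i < n) E i).
    elim: n => [|n IH].
      by rewrite bigcup_mkord big_ord0 /P preimage_set0 set0I mass0 content0.
    rewrite bigcup_mkord big_ord_recr/= -bigcup_mkord /P preimage_setU setIUl.
    have E0 : (Phi @^-1` (\bigcup_(i < n) E i) `&` S) `&`
        (Phi @^-1` E n `&` S) = set0.
      rewrite -subset0 => z [[[i /= ni Ei] _] [En _]].
      have : i = n by apply: tE => //; exists (Phi z).
      by move=> ein; rewrite ein ltnn in ni.
    by rewrite hL.2 ?hg.2//; try exact: mpreI; rewrite IH PE.
  apply/eqP; rewrite -subr_eq0 -normr_le0; apply/ler_addgt0Pl => e e0.
  have [n] := mass_remainder lam e0 mE; set D := _ `\` _ => De.
  have mD : measurable D by exact: measurableD.
  have split_tail f : finitely_additive f ->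
      (forall F, measurable F -> f (Phi @^-1` F) = mass lam F) ->
      f (Phi @^-1` (\bigcup_i E i) `&` S) -
      f (Phi @^-1` (\bigcup_(i < n) E i) `&` S) = f (Phi @^-1` D `&` S) /\
      0 <= f (Phi @^-1` D `&` S) < e.
    move=> hf flam; split; last first.
      rewrite (hf.1 _ (mpreI _ mD))/=; apply: le_lt_trans De.
      by rewrite -flam//; apply: (le_content hf) => //; [exact: mpreI|exact: mpre].
    rewrite -(contentD hf); [|exact: mpreI|exact: mpreI|].
      congr f; apply/seteqP; split=> z.
        by move=> [[zE zS] nz]; split => //; split => // zn; apply: nz.
      by move=> [[zE zn] zS]; split => // -[].
    by move=> z [[i _ Ei] zS]; split => //; exists i.
  have [Leq /andP[L0 Le]] := split_tail _ hL Llam.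
  have [geq /andP[g0 ge]] := split_tail _ hg glam.
  have := PU n; rewrite /P => PUn; rewrite addr0 ler_norml.
  by apply/andP; split; lra.
- by rewrite -GE.
Qed.

End dominated_content.

(** * Lower semicontinuity of integrals *)

Section content_lsc.
Context {R : realType} {d : measure_display} {Z : measurableType d}.

(** Agreement on an intersection-stable family passes to finite unions, and a
countable union only loses mass for a merely finitely additive [L]. *)
Lemma le_content_bigcup (L : set Z -> R) (g : {finite_measure set Z -> \bar R})
    (Q : set (set Z)) (A : nat -> set Z) :
  finitely_additive L -> Q `<=` measurable -> setI_closed Q ->
  (forall B, Q B -> L B = mass g B) -> (forall i, Q (A i)) ->
  mass g (\bigcup_i A i) <= L (\bigcup_i A i).
Proof.
move=> hL mQ IQ Lg QA; have mA i : measurable (A i) by exact: mQ.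
have mU n : measurable (\bigcup_(i < n) A i) by exact: bigcup_measurable.
have mUT : measurable (\bigcup_i A i) by exact: bigcupT_measurable.
apply/ler_addgt0Pr => e e0.
have [n hn] := mass_remainder g e0 mA.
have subn : \bigcup_(i < n) A i `<=` \bigcup_i A i by move=> z [i _ Ai]; exists i.
rewrite (contentD (mass_content g)) // in hn.
have := le_content hL (mU n) mUT subn.
have : L (\bigcup_(i < n) A i) = mass g (\bigcup_(i < n) A i).
  rewrite bigcup_mkord.
  exact: (eq_content_bigsetU hL (mass_content g) mQ IQ Lg).
by lra.
Qed.

End content_lsc.

Section staircase.
Context {R : realType}.

(** For [0 < t], the largest multiple of [e] strictly below [t], cut off at
[n * e]; written as a sum so that its integral involves superlevel sets only. *)
Definition staircase (e : R) (n : nat) (t : R) : R :=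
  \sum_(k < n) e * (k.+1%:R * e < t)%R%:R.

Lemma staircaseS e n t :
  staircase e n.+1 t = staircase e n t + e * (n.+1%:R * e < t)%R%:R.
Proof. by rewrite /staircase big_ord_recr. Qed.

Lemma staircaseP e n t : 0 < e -> 0 <= t ->
  if n%:R * e < t then staircase e n t = n%:R * e
  else t - e <= staircase e n t <= t.
Proof.
move=> e0 t0; elim: n => [|n IH].
  rewrite mul0r /staircase big_ord0; case: ifP => // /negbT.
  by rewrite -leNgt => t0'; apply/andP; split; lra.
have nS : n.+1%:R * e = n%:R * e + e by rewrite -natr1 mulrDl mul1r.
rewrite staircaseS; case: ltP => h1 /=.
  by move: IH; case: ltP => h2 h3; [rewrite h3 nS; ring|lra].
move: IH; case: ltP => h2 h3; rewrite mulr0 addr0; last exact: h3.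
by rewrite h3; apply/andP; split; lra.
Qed.

Lemma staircase_le e n t : 0 < e -> 0 <= t -> staircase e n t <= t.
Proof.
move=> e0 t0; have := staircaseP n e0 t0; case: ltP => [h ->|_ /andP[]//].
exact: ltW.
Qed.

Lemma staircase_ge e n t : 0 < e -> 0 <= t ->
  Num.min t (n%:R * e) <= staircase e n t + e.
Proof.
move=> e0 t0; have := staircaseP n e0 t0.
by case: ltP => [h ->|h /andP[h1 h2]]; lra.
Qed.

Lemma staircase_ge0 e n t : 0 < e -> 0 <= staircase e n t.
Proof. by move=> e0; apply: sumr_ge0 => k _; rewrite mulr_ge0// ltW. Qed.

Context {d : measure_display} {Z : measurableType d}.
Variables (h : Z -> R).
Hypotheses (mh : measurable_fun setT h) (h0 : forall z, 0 <= h z).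

Lemma measurable_superlevel t : measurable [set z | t < h z].
Proof.
rewrite (_ : [set z | _] = setT `&` h @^-1` `]t, +oo[); first exact: mh.
by rewrite setTI; apply/seteqP; split=> z /=; rewrite in_itv/= andbT.
Qed.

Lemma staircase_indic e n z : (staircase e n (h z))%:E =
  (\sum_(k < n) e%:E * (\1_[set z | (k.+1%:R * e < h z)%R] z)%:E)%E.
Proof.
rewrite /staircase -sumEFin; apply: eq_bigr => k _.
by rewrite EFinM indicE mem_setE.
Qed.

Lemma measurable_staircase e n :
  measurable_fun setT (EFin \o (fun z => staircase e n (h z))).
Proof.
rewrite /comp (funext (staircase_indic e n)); apply: emeasurable_sum => k _.
apply: measurable_funeM => //; apply/measurable_EFinP.
by apply: measurable_indic; exact: measurable_superlevel.
Qed.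

Lemma integral_staircase (m : {finite_measure set Z -> \bar R}) e n : 0 < e ->
  (\int[m]_z (staircase e n (h z))%:E =
   (\sum_(k < n) e * mass m [set z | (k.+1%:R * e < h z)%R])%:E)%E.
Proof.
move=> e0; under eq_integral do rewrite staircase_indic.
have mind k : measurable_fun setT
    (EFin \o (\1_[set z | (k%:R * e < h z)%R] : Z -> R)).
  apply/measurable_EFinP; apply: measurable_indic; exact: measurable_superlevel.
rewrite ge0_integral_sum//; last first.
- by move=> k z _; rewrite mule_ge0// lee_fin ltW.
- by move=> k; rewrite /=; apply: measurable_funeM => //; exact: mind k.+1.
rewrite -sumEFin; apply: eq_bigr => k _.
rewrite ge0_integralZl_EFin//; [|exact: mind k.+1|exact: ltW].
rewrite integral_indic//; last exact: measurable_superlevel.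
rewrite setIT EFinM; congr (_ * _)%E; apply: massE; exact: measurable_superlevel.
Qed.

Lemma staircase_sum_le_integral (m : {finite_measure set Z -> \bar R}) e n :
  0 < e ->
  ((\sum_(k < n) e * mass m [set z | (k.+1%:R * e < h z)%R])%:E
   <= \int[m]_z (h z)%:E)%E.
Proof.
move=> e0; rewrite -integral_staircase//; apply: ge0_le_integral => //.
- by move=> z _; rewrite lee_fin staircase_ge0.
- exact: measurable_staircase.
- exact/measurable_EFinP.
- by move=> z _; rewrite lee_fin staircase_le.
Qed.

(** Truncate [h] at an integer [n] that the monotone convergence theorem provides,
then refine the steps while keeping the top of the staircase at [n]. *)
Lemma lt_integral_staircase (m : {finite_measure set Z -> \bar R}) (M : R) :
  (M%:E < \int[m]_z (h z)%:E)%E ->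
  exists e n, 0 < e /\
    M < \sum_(k < n) e * mass m [set z | k.+1%:R * e < h z].
Proof.
move=> Mh.
have mmin (n : nat) :
    measurable_fun setT (EFin \o (fun z => Num.min (h z) n%:R)).
  by apply/measurable_EFinP; apply: measurable_minr.
have min0 (n : nat) z : 0 <= Num.min (h z) n%:R by rewrite le_min h0 ler0n.
have cvgI : (\int[m]_z (Num.min (h z) n%:R)%:E)%E @[n --> \oo] -->
    (\int[m]_z (h z)%:E)%E.
  under [X in _ --> X]eq_integral => z _.
    rewrite (_ : (h z)%:E = limn (fun n => (Num.min (h z) n%:R)%:E)); first over.
    apply/esym/cvg_lim => //; apply: cvg_EFin; first exact: nearW.
    apply: cvg_near_cst; near=> n; apply/min_idPl.
    by near: n; exact: nbhs_infty_ger.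
  apply: cvg_monotone_convergence => //.
  - by move=> n z _; rewrite lee_fin.
  - move=> z _ i j ij; rewrite lee_fin le_min ge_min lexx /= ge_min.
    by rewrite ler_nat ij orbT.
have [n [n0 hn]] : exists n, (0 < n)%N /\
    (M%:E < \int[m]_z (Num.min (h z) n%:R)%:E)%E.
  have /cvgI [N _ hN] : nbhs (\int[m]_z (h z)%:E)%E [set x | (M%:E < x)%E].
    exact: open_ereal_gt'.
  by exists N.+1; split => //; exact: hN (leqnSn N).
have [I eI] : exists I : R, (\int[m]_z (Num.min (h z) n%:R)%:E = I%:E)%E.
  have : (\int[m]_z (Num.min (h z) n%:R)%:E \is a fin_num)%E; last first.
    by move=> /fineK <-; eexists.
  rewrite ge0_fin_numE; last by apply: integral_ge0 => z _; rewrite lee_fin.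
  apply: (@le_lt_trans _ _ (\int[m]_z (cst n%:R%:E z))%E).
    apply: ge0_le_integral => //.
    - by move=> z _; rewrite lee_fin.
    - exact: mmin.
    - by move=> z _; rewrite lee_fin ge_min lexx orbT.
  by rewrite integral_cst// [X in (_ * X)%E](massE m measurableT) -EFinM ltry.
rewrite eI lte_fin in hn.
have nR : 0 < n%:R :> R by rewrite ltr0n.
have T0 : 0 <= mass m setT by exact: (mass_content m).1.
have den0 : 0 < n%:R * (mass m setT + 1) by rewrite mulr_gt0//; lra.
have sl : 0 < (I - M) / (n%:R * (mass m setT + 1)) by rewrite divr_gt0//; lra.
have [K hK] := mesh_lt sl.
rewrite ltr_pdivlMr// in hK.
pose e := n%:R * mesh K : R.
have e0 : 0 < e by rewrite mulr_gt0// mesh_gt0.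
have Ke : K.+1%:R * e = n%:R by rewrite /e /mesh mulrCA divff ?mulr1.
exists e, K.+1; split => //.
suff : I <= \sum_(k < K.+1) e * mass m [set z | k.+1%:R * e < h z] +
    e * mass m setT.
  have : e * mass m setT < I - M.
    apply: le_lt_trans hK; rewrite mulrA (mulrC (mesh K)) -/e.
    by rewrite ler_pM2l//; lra.
  lra.
rewrite -lee_fin -eI EFinD -integral_staircase// EFinM -(massE m measurableT).
rewrite -integral_cst// -ge0_integralD//.
- apply: ge0_le_integral => //.
  + by move=> z _; rewrite lee_fin.
  + exact: mmin.
  + by apply: emeasurable_funD => //; exact: measurable_staircase.
  + by move=> z _; rewrite -Ke -EFinD lee_fin staircase_ge.
- by move=> z _; rewrite lee_fin staircase_ge0.
- exact: measurable_staircase.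
- by move=> z _; rewrite lee_fin ltW.
Unshelve. all: by end_near. Qed.

End staircase.

Section integral_lsc.
Context {J : Type} {U : set_system J} {UU : UltraFilter U} {R : realType}.
Context {d : measure_display} {Z : measurableType d}.

(** A Riemann sum of the layer-cake formula involves finitely many superlevel
sets, so lower semicontinuity on those sets is enough. *)
Lemma integral_limit_mass_gt (m : J -> probability Z R)
    (g : {finite_measure set Z -> \bar R}) (h : Z -> R) (M : R) :
  measurable_fun setT h -> (forall z, 0 <= h z) ->
  (forall t, mass g [set z | t < h z] <= limit_mass (U := U) m [set z | t < h z]) ->
  (M%:E < \int[g]_z (h z)%:E)%E ->
  \forall j \near U, (M%:E < \int[m j]_z (h z)%:E)%E.
Proof.
move=> mh h0 glim /(lt_integral_staircase mh h0)[e [n [e0 Mlt]]].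
pose A (k : nat) := [set z | k.+1%:R * e < h z].
have mA k : measurable (A k) by exact: measurable_superlevel.
have cvgS : \sum_(k < n) e * mass (m j) (A k) @[j --> U] -->
    \sum_(k < n) e * limit_mass (U := U) m (A k).
  apply: cvg_big => [|k _]; first exact: add_continuous.
  by apply: cvgMl_tmp; exact: cvg_limit_mass.
have Mlim : M < \sum_(k < n) e * limit_mass (U := U) m (A k).
  apply: lt_le_trans Mlt _; apply: ler_sum => k _.
  by rewrite ler_pM2l//; exact: glim.
apply: filterS (cvgr_gt _ cvgS _ Mlim) => j /= hj.
apply: lt_le_trans (staircase_sum_le_integral mh h0 (m j) n e0).
by rewrite lte_fin.
Qed.

End integral_lsc.

(** * Integrals and images of measures *)

Lemma image_measure {d d' : measure_display} {R : realType}
    {Z : measurableType d} {W : measurableType d'}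
    (m : {measure set Z -> \bar R}) (f : Z -> W) : measurable_fun setT f ->
  exists m' : {measure set W -> \bar R}, forall A, m' A = m (f @^-1` A).
Proof.
move=> mf; unshelve eexists.
  by apply: [the measure _ _ of pushforward m f]; exact: mf.
by [].
Qed.

Section integral_lemmas.
Context {R : realType} {d : measure_display} {Z : measurableType d}.
Local Open Scope ereal_scope.

(** When [h] has infinite integral, the negative part of [h + k] is still bounded by
that of [k], so the positive part has infinite integral. *)
Lemma integralD_ge0_integrable (m : {measure set Z -> \bar R}) (h k : Z -> R) :
  measurable_fun setT h -> (forall z, (0 <= h z)%R) ->
  m.-integrable setT (EFin \o k) ->
  \int[m]_z (h z + k z)%:E = \int[m]_z (h z)%:E + \int[m]_z (k z)%:E.
Proof.
move=> mh h0 ik; have mk : measurable_fun setT k.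
  exact/measurable_EFinP/(measurable_int _ ik).
have mhk : measurable_fun setT (EFin \o (fun z => h z + k z)%R).
  by apply/measurable_EFinP; exact: measurable_funD.
have mEh : measurable_fun setT (EFin \o h) by exact/measurable_EFinP.
have [ih|nih] := pselect (m.-integrable setT (EFin \o h)).
  by rewrite -integralD//; apply: eq_integral => z _; rewrite EFinD.
have -> : \int[m]_z (h z)%:E = +oo.
  apply/eqP; rewrite -leye_eq leNgt; apply/negP => hoo; apply: nih.
  apply/integrableP; split => //; under eq_integral => z _.
    by rewrite /= ger0_norm//; over.
  by [].
rewrite addye; last first.
  by have := integrable_fin_num measurableT ik; rewrite fin_numE => /andP[].
have negfin : \int[m]_z ((EFin \o (fun z => h z + k z)%R)^\- z) \is a fin_num.
  rewrite ge0_fin_numE; last by apply: integral_ge0.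
  apply: le_lt_trans (integrable_lty _ (integrable_funeneg _ ik)) => //.
  apply: ge0_le_integral => //.
  - exact: measurable_funeneg.
  - by apply: measurable_funeneg; exact/measurable_EFinP.
  - move=> z _; apply: (@funeneg_le _ _ setT) => //; last by rewrite inE.
    by move=> y _; rewrite lee_fin lerDr.
suff ipos : \int[m]_z ((EFin \o (fun z => h z + k z)%R)^\+ z) = +oo.
  rewrite integralE ipos addye//.
  by move: negfin; rewrite fin_numE eqe_oppLR => /andP[].
apply/eqP; rewrite -leye_eq leNgt; apply/negP => posoo; apply: nih.
apply/integrableP; split => //; under eq_integral => z _.
  by rewrite /= ger0_norm//; over.
have kneg := integrable_lty measurableT (integrable_funeneg measurableT ik).
apply: le_lt_trans (lte_add_pinfty posoo kneg).
have mEhk := measurable_funepos mhk.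
have mEk := measurable_funeneg (measurable_int _ ik).
rewrite -ge0_integralD//; apply: ge0_le_integral => //.
- by move=> z _; rewrite lee_fin.
- exact: emeasurable_funD.
- move=> z _; rewrite (_ : (h z)%:E = (h z + k z)%:E + - (k z)%:E).
    by rewrite funeposE funenegE; apply: leeD; rewrite le_max lexx.
  by rewrite EFinD addeK.
Qed.

Context {d' : measure_display} {W : measurableType d'}.
Variables (m : {measure set Z -> \bar R}) (lam : {measure set W -> \bar R}).
Variable Phi : Z -> W.
Hypothesis mPhi : measurable_fun setT Phi.
Hypothesis Philam : forall F, measurable F -> m (Phi @^-1` F) = lam F.

Lemma integrable_image (f : W -> R) : lam.-integrable setT (EFin \o f) ->
  m.-integrable setT (EFin \o (f \o Phi)).
Proof.
move=> /integrableP[mf foo]; apply/integrableP; split.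
  exact: (measurableT_comp mf mPhi).
apply: le_lt_trans foo; rewrite (eq_measure_integral (pushforward m Phi)).
  by rewrite (ge0_integral_pushforward mPhi)//; exact: measurableT_comp mf.
by move=> A mA _; rewrite -Philam.
Qed.

Lemma integral_image (f : W -> R) : lam.-integrable setT (EFin \o f) ->
  \int[m]_z (f (Phi z))%:E = \int[lam]_w (f w)%:E.
Proof.
move=> iF; have iF' := integrable_image iF.
rewrite [RHS](eq_measure_integral (pushforward m Phi)).
  rewrite (integral_pushforward mPhi)// ?preimage_setT//.
  exact: measurable_int iF.
by move=> A mA _; rewrite -Philam.
Qed.

End integral_lemmas.

(** * Rectangles and squares of couplings *)

Section rectangles.
Context {dX dY : measure_display} {X : measurableType dX} {Y : measurableType dY}.

(** An alias that carries the semiring of rectangles instead of the sigma-algebra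
of the product. *)
Definition rect_type : Type := (X * Y)%type.

Definition rects : set (set rect_type) :=
  [set A `*` B | A in @measurable _ X & B in @measurable _ Y].

Lemma rects0 : rects set0.
Proof. by exists set0 => //; exists set0 => //; rewrite set0X. Qed.

Lemma rectsI : setI_closed rects.
Proof.
move=> _ _ [A mA [B mB <-]] [A' mA' [B' mB' <-]]; exists (A `&` A').
  exact: measurableI.
by exists (B `&` B'); [exact: measurableI|rewrite setXI].
Qed.

Lemma rectsD : semi_setD_closed rects.
Proof.
move=> _ _ [A mA [B mB <-]] [A' mA' [B' mB' <-]].
exists [set (A `\` A') `*` B; (A `&` A') `*` (B `\` B')]; split.
- exact: finite_set2.
- move=> _ [->|->].
    by exists (A `\` A'); [exact: measurableD|exists B].
  exists (A `&` A'); [exact: measurableI|exists (B `\` B') => //].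
  exact: measurableD.
- rewrite bigcup_setU !bigcup_set1; apply/seteqP; split=> -[x y] /=.
    move=> [[Ax By] nxy]; have [A'x|nA'x] := pselect (A' x); last by left.
    by right; split => //; split => // B'y; apply: nxy.
  by move=> [[[Ax nA'x] By]|[[Ax A'x] [By nB'y]]]; split => // -[].
- move=> _ _ [->|->] [->|->] // [[x y]] /=; first by move=> [[[_ ?] _] [[_ ?] _]].
  by move=> [[[_ ?] _] [[_ ?] _]].
Qed.

Definition rect_display : measure_display.
Proof. exact: default_measure_display. Qed.

HB.instance Definition _ := Pointed.on rect_type.
HB.instance Definition _ :=
  @isSemiRingOfSets.Build rect_display rect_type rects rects0 rectsI rectsD.

End rectangles.
Arguments rect_type {dX dY} X Y.

Section squares.
Context {R : realType} {d : measure_display} {Z : measurableType d}.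

Definition square (p : probability Z R) : probability (Z * Z)%type R :=
  [the probability _ _ of (p \x p)%E].

Lemma mass_square (p : probability Z R) A B : measurable A -> measurable B ->
  mass (square p) (A `*` B) = mass p A * mass p B.
Proof.
move=> mA mB; apply: EFin_inj; rewrite EFinM -!massE//; last exact: measurableX.
exact: product_measure1E.
Qed.

End squares.

Section square_image.
Context {R : realType} {d d' : measure_display}.
Context {Z : measurableType d} {W : measurableType d'}.

Lemma square_image (p : probability Z R) (q : probability W R) (f : Z -> W) :
  measurable_fun setT f ->
  (forall A, measurable A -> p (f @^-1` A) = q A) ->
  forall F, measurable F ->
    square p ((fun z => (f z.1, f z.2)) @^-1` F) = square q F.
Proof.
move=> mf fpq F mF.
have mff : measurable_fun setT (fun z : Z * Z => (f z.1, f z.2)).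
  by apply: measurable_fun_pair; apply: measurableT_comp.
have mpre (A : set W) : measurable A -> measurable (f @^-1` A).
  by move=> mA; exact: (preimage_measurable mf).
have [m mE] := image_measure (square p) mff.
rewrite -mE; apply/esym/product_measure_unique => // A B mA mB.
rewrite mE; transitivity (p (f @^-1` A) * p (f @^-1` B))%E; last first.
  by congr (_ * _)%E; exact: fpq.
exact: (product_measure1E p p (mpre _ mA) (mpre _ mB)).
Qed.

End square_image.

Section limit_plan.
Context {R : realType} {dX dY : measure_display}.
Context {X : measurableType dX} {Y : measurableType dY}.
Variables (mu : probability X R) (nu : probability Y R).
Let plan := probability (X * Y)%type R.

Definition fst_pair (z : (X * Y) * (X * Y)) : X * X := (z.1.1, z.2.1).
Definition snd_pair (z : (X * Y) * (X * Y)) : Y * Y := (z.1.2, z.2.2).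

Lemma measurable_fst_pair : measurable_fun setT fst_pair.
Proof.
apply: measurable_fun_pair.
  exact: (measurableT_comp measurable_fst measurable_fst).
exact: (measurableT_comp measurable_fst measurable_snd).
Qed.

Lemma measurable_snd_pair : measurable_fun setT snd_pair.
Proof.
apply: measurable_fun_pair.
  exact: (measurableT_comp measurable_snd measurable_fst).
exact: (measurableT_comp measurable_snd measurable_snd).
Qed.

Lemma square_fst_pair (p : plan) : couplings mu nu p ->
  forall F, measurable F -> square p (fst_pair @^-1` F) = square mu F.
Proof.
by move=> [pX _]; apply: (square_image (f := fst)); [exact: measurable_fst|].
Qed.

Lemma square_snd_pair (p : plan) : couplings mu nu p ->
  forall G, measurable G -> square p (snd_pair @^-1` G) = square nu G.
Proof.
by move=> [_ pY]; apply: (square_image (f := snd)); [exact: measurable_snd|].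
Qed.

(** Rectangles of the product [(X * X) * (Y * Y)], in which a squared coupling of
[mu] and [nu] is itself a coupling, of the squares of [mu] and [nu]. *)
Definition join_rect (F : set (X * X)) (G : set (Y * Y)) :
    set ((X * Y) * (X * Y)) :=
  fst_pair @^-1` F `&` snd_pair @^-1` G.

Definition join_rects : set (set ((X * Y) * (X * Y))) :=
  [set S | exists F G, [/\ measurable F, measurable G & S = join_rect F G]].

Lemma measurable_join_rect F G : measurable F -> measurable G ->
  measurable (join_rect F G).
Proof.
move=> mF mG; apply: measurableI.
  exact: (preimage_measurable measurable_fst_pair).
exact: (preimage_measurable measurable_snd_pair).
Qed.

Lemma join_rectsI : setI_closed join_rects.
Proof.
move=> _ _ [F [G [mF mG ->]]] [F' [G' [mF' mG' ->]]].
exists (F `&` F'), (G `&` G'); split; try exact: measurableI.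
by rewrite /join_rect !preimage_setI setIACA.
Qed.

Variables (U : set_system plan) (UU : UltraFilter U) (pi : plan).
Hypothesis U_coupling : U (couplings mu nu).
Hypothesis pi_coupling : couplings mu nu pi.
Hypothesis U_pi : forall A B, measurable A -> measurable B ->
  limit_mass (U := U) id (A `*` B) = mass pi (A `*` B).

Notation limit_square := (limit_mass (U := U) (@square R _ (X * Y)%type)).

Lemma limit_square_rect A A' B B' :
  measurable A -> measurable A' -> measurable B -> measurable B' ->
  limit_square (join_rect (A `*` A') (B `*` B')) =
  mass (square pi) (join_rect (A `*` A') (B `*` B')).
Proof.
move=> mA mA' mB mB'.
have -> : join_rect (A `*` A') (B `*` B') = (A `*` B) `*` (A' `*` B').
  by apply/seteqP; split=> -[[x y] [x' y']] /= [[? ?] [? ?]].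
have mAB := measurableX mA mB; have mAB' := measurableX mA' mB'.
rewrite mass_square// -!U_pi//; apply: cvg_lim => //.
rewrite [X in X @ _ --> _](_ : _ = fun p : plan =>
    mass p (A `*` B) * mass p (A' `*` B')).
  by apply: cvgM; exact: cvg_limit_mass.
by apply/funext => p; exact: mass_square.
Qed.

(** On products of four sets the squares converge since the factors do; each pair
of coordinates is then extended to arbitrary sets in turn, the other one being
kept fixed. *)
Lemma limit_square_join F G : measurable F -> measurable G ->
  limit_square (join_rect F G) = mass (square pi) (join_rect F G).
Proof.
have limX F' : measurable F' ->
    limit_square (fst_pair @^-1` F') = mass (square mu) F'.
  move=> mF'; apply: limit_mass_eq.
    exact: (preimage_measurable measurable_fst_pair).
  apply: filterS U_coupling => p hp; congr fine; exact: square_fst_pair.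
have limY G' : measurable G' ->
    limit_square (snd_pair @^-1` G') = mass (square nu) G'.
  move=> mG'; apply: limit_mass_eq.
    exact: (preimage_measurable measurable_snd_pair).
  apply: filterS U_coupling => p hp; congr fine; exact: square_snd_pair.
have piX F' : measurable F' ->
    mass (square pi) (fst_pair @^-1` F') = mass (square mu) F'.
  by move=> mF'; congr fine; exact: square_fst_pair.
have piY G' : measurable G' ->
    mass (square pi) (snd_pair @^-1` G') = mass (square nu) G'.
  by move=> mG'; congr fine; exact: square_snd_pair.
have hL := @limit_mass_content _ U UU R _ _ (@square R _ (X * Y)%type).
move=> mF mG; rewrite /join_rect setIC.
apply: (content_unique hL measurable_snd_pair limY piY _
  (measurable_prod_measurableType Y Y)) => //.
- exact: (preimage_measurable measurable_fst_pair).
- exact: (@rectsI _ _ Y Y).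
- by rewrite limX// piX.
move=> _ [B mB [B' mB' <-]]; rewrite setIC.
move: F mF; apply: (content_unique hL measurable_fst_pair limX piX _
  (measurable_prod_measurableType X X)) => //.
- by apply: (preimage_measurable measurable_snd_pair); exact: measurableX.
- exact: (@rectsI _ _ X X).
- by rewrite limY ?piY//; exact: measurableX.
by move=> _ [A mA [A' mA' <-]]; exact: limit_square_rect.
Qed.

End limit_plan.

(** * Lower semicontinuity of the cost *)

Section cost_lsc.
Context {R : realType} {dX dY : measure_display}.
Context {X : measurableType dX} {Y : measurableType dY}.

Definition sigma_join_rects : set (set ((X * Y) * (X * Y))) :=
  [set S | exists A : nat -> set ((X * Y) * (X * Y)),
    (forall i, join_rects (A i)) /\ S = \bigcup_i A i].

Lemma join_rects0 : @join_rects _ _ X Y set0.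
Proof.
by exists set0, set0; split => //; rewrite /join_rect preimage_set0 set0I.
Qed.

Lemma sigma_join_rects_bigcup (I : countType)
    (S : I -> set ((X * Y) * (X * Y))) :
  (forall i, sigma_join_rects (S i)) -> sigma_join_rects (\bigcup_i S i).
Proof.
move=> hS; have [A hA] := choice hS.
exists (fun n => if unpickle n is Some (i, k) then A i k else set0); split.
  move=> n; case: unpickle => [[i k]|]; last exact: join_rects0.
  by case: (hA i).
apply/seteqP; split=> z.
  move=> [i _]; rewrite (hA i).2 => -[k _ Az].
  by exists (pickle (i, k)) => //; rewrite pickleK.
move=> [n _]; case: unpickle => [[i k]|//] Az.
by exists i => //; rewrite (hA i).2; exists k.
Qed.

Lemma sigma_join_rectsI S F G : sigma_join_rects S ->
  measurable F -> measurable G -> sigma_join_rects (S `&` join_rect F G).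
Proof.
move=> [A [hA ->]] mF mG; exists (fun i => A i `&` join_rect F G); split.
  by move=> i; apply: join_rectsI => //; exists F, G.
by rewrite setI_bigcupl.
Qed.

Variables (mu : probability X R) (nu : probability Y R).
Variable c : (X * Y) * (X * Y) -> R.
Hypothesis c_superlevel : forall r, sigma_join_rects [set z | r < c z].

(** Where [f + g < c - t], rationals can be inserted between the three terms; [f]
and [g] need not be semicontinuous since their level sets are rectangles. *)
Lemma excess_superlevel (f : X * X -> R) (g : Y * Y -> R) t :
  measurable_fun setT f -> measurable_fun setT g ->
  sigma_join_rects [set z | t < c z - (f (fst_pair z) + g (snd_pair z))].
Proof.
move=> mf mg.
have mlt d (Z : measurableType d) (k : Z -> R) r : measurable_fun setT k ->
    measurable [set z | k z < r].
  move=> mk; rewrite (_ : [set z | _] = setT `&` k @^-1` `]-oo, r[).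
    exact: mk.
  by rewrite setTI; apply/seteqP; split=> z /=; rewrite in_itv.
rewrite (_ : [set z | _] = \bigcup_(q : rat * rat)
    ([set z | ratr q.1 + ratr q.2 + t < c z] `&`
     join_rect [set x | f x < ratr q.1] [set y | g y < ratr q.2])).
  apply: sigma_join_rects_bigcup => q.
  by apply: sigma_join_rectsI; [exact: c_superlevel|exact: mlt|exact: mlt].
apply/seteqP; split=> z /=; last first.
  by move=> [[q1 q2] _ /= [cz [/= fz gz]]]; move: cz fz gz; rewrite /=; lra.
move=> tz; pose s := c z - (f (fst_pair z) + g (snd_pair z)) - t.
have s0 : 0 < s / 2 by rewrite /s; lra.
have pick_rat (r : R) : exists q, r < ratr q < r + s / 2.
  have [|q] := @rat_in_itvoo R r (r + s / 2); first by rewrite ltrDl.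
  by rewrite in_itv; exists q.
have [q1 /andP[f1 f2]] := pick_rat (f (fst_pair z)).
have [q2 /andP[g1 g2]] := pick_rat (g (snd_pair z)).
exists (q1, q2) => //; split; first by rewrite /=; rewrite /s in f2 g2; lra.
by split.
Qed.

Local Notation plan := (probability (X * Y)%type R).
Variables (U : set_system plan) (UU : UltraFilter U) (pi : plan).
Hypothesis U_coupling : U (couplings mu nu).
Hypothesis pi_coupling : couplings mu nu pi.
Hypothesis U_pi : forall A B, measurable A -> measurable B ->
  limit_mass (U := U) id (A `*` B) = mass pi (A `*` B).

(** The part [f + g] of the cost has the same integral for all couplings, so only
the nonnegative excess [c - f - g] matters. *)
Lemma plan_cost_excess (f : X * X -> R) (g : Y * Y -> R) (p : plan) :
  measurable_fun setT c ->
  (mu \x mu)%E.-integrable setT (EFin \o f) ->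
  (nu \x nu)%E.-integrable setT (EFin \o g) ->
  (forall z, f (fst_pair z) + g (snd_pair z) <= c z) ->
  couplings mu nu p ->
  plan_cost p c =
    (\int[square p]_z (c z - (f (fst_pair z) + g (snd_pair z)))%:E +
    (\int[mu \x mu]_w (f w)%:E + \int[nu \x nu]_w (g w)%:E))%E.
Proof.
move=> mc intf intg fgc hp.
have iX := integrable_image measurable_fst_pair (square_fst_pair hp) intf.
have iY := integrable_image measurable_snd_pair (square_snd_pair hp) intg.
have mfX : measurable_fun setT (f \o @fst_pair _ _ X Y).
  by move/integrableP: iX => -[/measurable_EFinP iX _]; exact: iX.
have mgY : measurable_fun setT (g \o @snd_pair _ _ X Y).
  by move/integrableP: iY => -[/measurable_EFinP iY _]; exact: iY.
rewrite -(integral_image measurable_fst_pair (square_fst_pair hp) intf).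
rewrite -(integral_image measurable_snd_pair (square_snd_pair hp) intg).
rewrite -integralD//.
have -> : (\int[square p]_z ((f (fst_pair z))%:E + (g (snd_pair z))%:E) =
    \int[square p]_z (f (fst_pair z) + g (snd_pair z))%:E)%E.
  by apply: eq_integral => z _; rewrite EFinD.
rewrite -integralD_ge0_integrable.
- by apply: eq_integral => z _; rewrite subrK.
- by apply: measurable_funB => //; exact: measurable_funD.
- by move=> z; rewrite subr_ge0.
- exact: (integrableD measurableT iX iY).
Qed.

(** [integral_limit_mass_gt] for the excess, shifted by the constant integral of
[f + g]. *)
Lemma plan_cost_lsc (M : R) : cost_class mu nu c -> (M%:E < plan_cost pi c)%E ->
  \forall p \near U, couplings mu nu p /\ (M%:E < plan_cost p c)%E.
Proof.
move=> [mc [f [g [intf intg fgc]]]].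
have fgc' z : f (fst_pair z) + g (snd_pair z) <= c z.
  by case: z => [[x y] [x' y']]; exact: fgc.
have mf : measurable_fun setT f by case/integrableP: intf => /measurable_EFinP.
have mg : measurable_fun setT g by case/integrableP: intg => /measurable_EFinP.
have iX := integrable_image measurable_fst_pair (square_fst_pair pi_coupling) intf.
have iY := integrable_image measurable_snd_pair (square_snd_pair pi_coupling) intg.
have mfX : measurable_fun setT (f \o @fst_pair _ _ X Y).
  by move/integrableP: iX => -[/measurable_EFinP iX _]; exact: iX.
have mgY : measurable_fun setT (g \o @snd_pair _ _ X Y).
  by move/integrableP: iY => -[/measurable_EFinP iY _]; exact: iY.
pose h z := c z - (f (fst_pair z) + g (snd_pair z)).
have mh : measurable_fun setT h.
  by apply: measurable_funB => //; exact: measurable_funD.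
have h0 z : 0 <= h z by rewrite subr_ge0.
have := integrable_fin_num measurableT intf.
have := integrable_fin_num measurableT intg.
set If := (\int[_]_w (EFin \o f) w)%E; set Ig := (\int[_]_w (EFin \o g) w)%E.
move=> fing finf.
have Ifg : (If + Ig = (fine If + fine Ig)%:E)%E by rewrite EFinD !fineK.
rewrite (plan_cost_excess mc intf intg fgc' pi_coupling) Ifg.
rewrite -lteBlDr// -EFinB => Mh.
have hlim : \forall p \near U,
    ((M - (fine If + fine Ig))%:E < \int[square p]_z (h z)%:E)%E.
  apply: (integral_limit_mass_gt mh h0 _ Mh) => t.
  have [A [hA ->]] := excess_superlevel t mf mg.
  apply: (le_content_bigcup (limit_mass_content _) _ _ _ hA).
  - by move=> _ [F [G [mF mG ->]]]; exact: measurable_join_rect.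
  - exact: join_rectsI.
  - move=> _ [F [G [mF mG ->]]].
    exact: (limit_square_join UU U_coupling pi_coupling U_pi).
apply: filterS2 U_coupling hlim => p hp hM; split => //.
by rewrite (plan_cost_excess mc intf intg fgc' hp) Ifg -lteBlDr// -EFinB.
Qed.

End cost_lsc.

(** * From a limit content to a coupling *)

Section rectangle_extension.
Context {R : realType} {dX dY : measure_display}.
Context {X : measurableType dX} {Y : measurableType dY}.
Variable L : set (X * Y) -> R.
Hypothesis hL : finitely_additive L.

Lemma rect_measurable (A : set (rect_type X Y)) : measurable A ->
  measurable (A : set (X * Y)).
Proof. by move=> [B mB [C mC <-]]; exact: measurableX. Qed.

(** Nonnegativity is asked of a content on all sets, hence the absolute value;
on rectangles this is [L]. *)
Definition rect_content (A : set (rect_type X Y)) : \bar R := `|L A|%:E.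

Let rect_content_ge0 A : (0 <= rect_content A)%E.
Proof. by rewrite lee_fin. Qed.

Let rect_contentE (A : set (X * Y)) : measurable A -> rect_content A = (L A)%:E.
Proof. by move=> mA; rewrite /rect_content ger0_norm//; exact: hL.1. Qed.

Let rect_content_semi_additive : measure_function.semi_additive rect_content.
Proof.
move=> F n mF tF _.
have mF' i : measurable (F i : set (X * Y)) by exact: rect_measurable.
elim: n => [|n IH].
  by rewrite !big_ord0 rect_contentE// (content0 hL).
rewrite !big_ord_recr/= -IH.
have mU : measurable (\big[setU/set0]_(i < n) F i : set (X * Y)).
  by apply: bigsetU_measurable.
rewrite !rect_contentE//; last exact: measurableU.
rewrite hL.2//; rewrite -bigcup_mkord -subset0 => z [[i /= ni Fi] Fn].
have : i = n by apply: tF => //; exists z.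
by move=> ein; rewrite ein ltnn in ni.
Qed.

HB.instance Definition _ := isContent.Build _ _ _ rect_content
  rect_content_ge0 rect_content_semi_additive.

Hypothesis L_sub :
  forall (A : set (rect_type X Y)) (F : nat -> set (rect_type X Y)),
  (forall n, measurable (F n)) -> measurable A -> A `<=` \bigcup_n F n ->
  forall e, 0 < e -> exists n, L A <= \sum_(i < n) L (F i) + e.

Let rect_content_sub : measurable_subset_sigma_subadditive rect_content.
Proof.
move=> A F mF mA AF.
have mA' := rect_measurable mA; have mF' n := rect_measurable (mF n).
apply/lee_addgt0Pr => e e0; have [n hn] := L_sub mF mA AF e0.
rewrite rect_contentE//; apply: (@le_trans _ _ (\sum_(i < n) L (F i) + e)%:E).
  by rewrite lee_fin.
rewrite EFinD; apply: leeD => //.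
rewrite -sumEFin -(big_mkord predT (fun i => (L (F i))%:E)).
rewrite (eq_bigr (fun i => rect_content (F i))) => [|i _]; last first.
  by rewrite rect_contentE.
by apply: nneseries_lim_ge.
Qed.

HB.instance Definition _ := Content_SigmaSubAdditive_isMeasure.Build _ _ _
  rect_content rect_content_sub.

Lemma rectangle_extension : exists m : {measure set (X * Y) -> \bar R},
  forall A B, measurable A -> measurable B -> m (A `*` B) = (L (A `*` B))%:E.
Proof.
pose E := g_sigma_algebraType (@measurable _ (rect_type X Y)).
have mid : measurable_fun setT (id : E -> (X * Y)%type).
  move=> _ A mA; rewrite setTI preimage_id.
  by move: mA; rewrite measurable_prod_measurableType.
have [m hm] := image_measure
  [the measure _ _ of measure_extension rect_content] mid.
exists m => A B mA mB; rewrite -rect_contentE; last exact: measurableX.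
rewrite hm preimage_id /= /measure_extension measurable_mu_extE//.
by exists A => //; exists B.
Qed.

End rectangle_extension.

Section unit_mass.
Context {d : measure_display} {Z : measurableType d} {R : realType}.
Variable m : {measure set Z -> \bar R}.
Hypothesis mT : m setT = 1%E.

(** A copy of [m] whose type records that it is a probability. *)
Definition unit_mass (_ : m setT = 1%E) : set Z -> \bar R := m.

HB.instance Definition _ := Measure.on (unit_mass mT).
HB.instance Definition _ := Measure_isProbability.Build _ _ _ (unit_mass mT) mT.

End unit_mass.

Section plan_of_limit.
Context {R : realType} {X Y : ptopologicalType}.
Hypotheses (hX : polish R X) (hY : polish R Y).
Variables (mu : probability (borel X) R) (nu : probability (borel Y) R).
Variable L : set (borel X * borel Y) -> R.
Hypothesis hL : finitely_additive L.
Hypothesis LX : forall A, measurable A -> L (A `*` setT) = mass mu A.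
Hypothesis LY : forall B, measurable B -> L (setT `*` B) = mass nu B.

Lemma sum_halving (e : R) n : 0 <= e -> \sum_(i < n) e / (2 ^ i.+1)%:R <= e.
Proof.
move=> e0; suff -> : \sum_(i < n) e / (2 ^ i.+1)%:R = e - e / (2 ^ n)%:R.
  by rewrite gerBl divr_ge0.
elim: n => [|n IH]; first by rewrite big_ord0 expn0 divr1 subrr.
rewrite big_ord_recr/= IH expnS natrM.
have : (2 ^ n)%:R != 0 :> R by rewrite pnatr_eq0 expn_eq0.
by move=> h; field.
Qed.

Lemma open_rect (A : set X) (B : set Y) :
  open A -> open B -> open (A `*` B : set (X * Y)).
Proof.
rewrite !openE => oA oB [x y] [/= Ax By]; exists (A, B) => //.
by split; [exact: oA|exact: oB].
Qed.

(** Changing the sides of a rectangle changes [L] by at most what the marginals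
see, so the rectangles may be replaced by compact ones inside and open ones
outside, where a countable cover has a finite subcover. *)
Lemma limit_sigma_subadditive (A : set (rect_type (borel X) (borel Y)))
    (F : nat -> set (rect_type (borel X) (borel Y))) :
  (forall n, measurable (F n)) -> measurable A -> A `<=` \bigcup_n F n ->
  forall e, 0 < e -> exists n, L A <= \sum_(i < n) L (F i) + e.
Proof.
move: hX hY => [sepX [distX hdX]] [sepY [distY hdY]].
move=> mF [A1 mA1 [A2 mA2 <-]] AF e e0.
have e40 : 0 < e / 4 by lra.
have e4n n : 0 < e / 4 / (2 ^ n.+1)%:R.
  by apply: divr_gt0 => //; rewrite ltr0n expn_gt0.
have bound (C1 D1 : set (borel X)) (C2 D2 : set (borel Y)) (r : R) :
    measurable C1 -> measurable D1 -> measurable C2 -> measurable D2 ->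
    mass mu (C1 `\` D1) < r -> mass nu (C2 `\` D2) < r ->
    L (C1 `*` C2) <= L (D1 `*` D2) + r + r.
  move=> mC1 mD1 mC2 mD2 h1 h2.
  have m12 := measurableD mC1 mD1; have m12' := measurableD mC2 mD2.
  have mS1 : measurable ((C1 `\` D1) `*` setT : set (borel X * borel Y)).
    exact: measurableX.
  have mS2 : measurable (setT `*` (C2 `\` D2) : set (borel X * borel Y)).
    exact: measurableX.
  have mDD := measurableX mD1 mD2.
  have mU := measurableU _ _ mDD mS1.
  have : L (C1 `*` C2) <=
      L ((D1 `*` D2) `|` ((C1 `\` D1) `*` setT) `|` (setT `*` (C2 `\` D2))).
    apply: (le_content hL); [exact: measurableX|exact: measurableU|].
    move=> [x y] [/= C1x C2y].
    have [D1x|nD1x] := pselect (D1 x); last by left; right.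
    by have [D2y|nD2y] := pselect (D2 y); [left; left|right].
  have := contentU_le hL mU mS2; have := contentU_le hL mDD mS1.
  by rewrite LX// LY//; lra.
have [K1 [cK1 compK1 KA1 hK1]] := inner_compact hdX mu sepX mA1 e40.
have [K2 [cK2 compK2 KA2 hK2]] := inner_compact hdY nu sepY mA2 e40.
have sides n : exists S : set (borel X) * set (borel Y),
    [/\ measurable S.1, measurable S.2 & F n = S.1 `*` S.2].
  by have [B mB [C mC BC]] := mF n; exists (B, C).
have [S hS] := choice sides.
have enlarge n : exists V : set X * set Y, [/\ open V.1, open V.2,
    (F n : set (X * Y)) `<=` V.1 `*` V.2 &
    L ((V.1 : set (borel X)) `*` (V.2 : set (borel Y))) <=
      L (F n) + e / 4 / (2 ^ n.+1)%:R + e / 4 / (2 ^ n.+1)%:R].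
  have [mS1 mS2 FS] := hS n.
  have [V1 [oV1 SV1 hV1]] := outer_open hdX mu mS1 (e4n n).
  have [V2 [oV2 SV2 hV2]] := outer_open hdY nu mS2 (e4n n).
  exists (V1, V2); split => //; first by rewrite FS => -[x y] [/SV1 ? /SV2 ?].
  by rewrite FS; apply: bound => //; exact: open_borel.
have [V hV] := choice enlarge.
have := compact_setX compK1 compK2.
pose XY : ptopologicalType := HB.pack (X * Y)%type
  (Pointed.on (X * Y)%type) (Topological.on (X * Y)%type).
rewrite (@compact_cover XY).
move=> /(_ nat setT (fun n => (V n).1 `*` (V n).2)) [|z [K1z K2z]|D _ Dcov].
- by move=> n _; case: (hV n) => oV1 oV2 _ _; exact: open_rect.
- have [n _ Fz] : (\bigcup_n F n) z by apply: AF; split; [exact: KA1|exact: KA2].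
  by exists n => //; case: (hV n) => _ _ h _; exact: h.
have [s sD] := (finite_seqP _).1 (finite_fset D).
have [n hn] : exists n, forall i, i \in s -> (i < n)%N.
  exists (\max_(i <- s) i).+1 => i /= si; rewrite ltnS.
  by rewrite (big_rem i)//= leq_maxl.
rewrite {}sD in Dcov.
exists n.
have mK1 := closed_borel cK1; have mK2 := closed_borel cK2.
have mV i : measurable ((V i).1 `*` (V i).2 : set (borel X * borel Y)).
  by case: (hV i) => o1 o2 _ _; apply: measurableX; exact: open_borel.
have h1 := bound _ _ _ _ _ mA1 mK1 mA2 mK2 hK1 hK2.
have h2 : L ((K1 : set (borel X)) `*` (K2 : set (borel Y))) <=
    L (\big[setU/set0]_(i < n) ((V i).1 `*` (V i).2 : set (borel X * borel Y))).
  apply: (le_content hL); [exact: measurableX|exact: bigsetU_measurable|].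
  move=> z Kz; have [i Di Vz] := Dcov z Kz.
  rewrite -(bigcup_mkord n
    (fun i => (V i).1 `*` (V i).2 : set (borel X * borel Y))).
  by exists i => //=; exact: hn.
have h3 := content_bigsetU_le hL n mV.
have h4 : \sum_(i < n) L ((V i).1 `*` (V i).2 : set (borel X * borel Y)) <=
    \sum_(i < n) L (F i) + e / 4 + e / 4.
  apply: (@le_trans _ _ (\sum_(i < n) (L (F i) + e / 4 / (2 ^ i.+1)%:R +
      e / 4 / (2 ^ i.+1)%:R))).
    by apply: ler_sum => i _; case: (hV i).
  rewrite !big_split/=; have := @sum_halving (e / 4) n (ltW e40); lra.
lra.
Qed.

Lemma plan_of_content : exists2 pi : probability (borel X * borel Y)%type R,
  couplings mu nu pi &
  forall A B, measurable A -> measurable B -> mass pi (A `*` B) = L (A `*` B).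
Proof.
have [m hm] := rectangle_extension hL limit_sigma_subadditive.
have mT : m setT = 1%E.
  by rewrite -setXTT hm// LX// -massE//; exact: probability_setT.
pose p : probability (borel X * borel Y)%type R :=
  [the probability _ _ of unit_mass mT].
exists p; last by move=> A B mA mB; rewrite /mass hm.
split=> [A mA|B mB]; rewrite /pushforward.
  rewrite -setXT.
  by rewrite hm// LX// massE.
rewrite -setTX.
by rewrite hm// LY// massE.
Qed.

End plan_of_limit.

(** * Existence of a minimizer *)

Section minimizer.
Context {R : realType} {X Y : ptopologicalType}.
Hypotheses (hX : polish R X) (hY : polish R Y).

Lemma polish_base {T : ptopologicalType} : polish R T ->
  exists V : nat -> set T, (forall n, open (V n)) /\
    forall (O : set T) x, open O -> O x -> exists2 n, V n x & V n `<=` O.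
Proof.
move=> [sepT [dist hd]]; have [s hs] := separable_seq sepT.
exists (ball_seq (dist := dist) s); split=> [n|O x]; first exact: ball_seq_open.
exact: ball_seq_base.
Qed.

(** An open set is the union of the boxes of basic open sets that it contains, and
a box regroups into a rectangle of [(X * X) * (Y * Y)]. *)
Lemma open_sigma_join_rects (O : set ((X * Y) * (X * Y))) : open O ->
  sigma_join_rects (O : set ((borel X * borel Y) * (borel X * borel Y))).
Proof.
move=> oO; have [V [oV baseV]] := polish_base hX.
have [W [oW baseW]] := polish_base hY.
pose box (q : (nat * nat) * (nat * nat)) :
    set ((borel X * borel Y) * (borel X * borel Y)) :=
  @join_rect _ _ (borel X) (borel Y) (V q.1.1 `*` V q.1.2) (W q.2.1 `*` W q.2.2).
rewrite (_ : O = \bigcup_q (if pselect (box q `<=` O) then box q else set0)).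
  apply: sigma_join_rects_bigcup => q; case: pselect => boxO; last first.
    by exists (fun=> set0); split; [move=> _; exact: join_rects0|rewrite bigcup0].
  exists (fun=> box q); split; last first.
    by apply/seteqP; split=> z; [move=> ?; exists 0|case].
  move=> _; exists (V q.1.1 `*` V q.1.2), (W q.2.1 `*` W q.2.2).
  by split => //; apply: measurableX; exact: open_borel.
apply/seteqP; split=> z; last by move=> [q _]; case: pselect => // boxO /boxO.
have nbase (T : ptopologicalType) (B : nat -> set T) (P : set T) x :
    (forall (O : set T) x, open O -> O x -> exists2 n, B n x & B n `<=` O) ->
    nbhs x P -> exists2 n, B n x & B n `<=` P.
  move=> baseB; rewrite nbhsE => -[N [oN Nx] NP].
  by have [n Bx BN] := baseB N x oN Nx; exists n => //; exact: subset_trans NP.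
move: z => [[x y] [x' y']] Oz.
have : nbhs (x, y, (x', y')) O by exact: open_nbhs_nbhs.
move=> [[P P'] /= [[[P1 P2] /= [nP1 nP2] sP] [[P3 P4] /= [nP3 nP4] sP']] sO].
have [i Vx VP1] := nbase _ _ _ _ baseV nP1.
have [j Wy WP2] := nbase _ _ _ _ baseW nP2.
have [k Vx' VP3] := nbase _ _ _ _ baseV nP3.
have [l Wy' WP4] := nbase _ _ _ _ baseW nP4.
exists ((i, k), (j, l)) => //; case: pselect => [boxO|nbox]; first by split.
exfalso; apply: nbox => -[[u v] [u' v']] /= [[/= Vu Vu'] [/= Wv Wv']].
apply: (sO (u, v, (u', v'))); split => /=.
  by apply: (sP (u, v)); split => /=; [exact: VP1|exact: WP2].
by apply: (sP' (u', v')); split => /=; [exact: VP3|exact: WP4].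
Qed.

Lemma lsc_superlevel (c : (X * Y) * (X * Y) -> R) r :
  lower_semicontinuous (EFin \o c) ->
  sigma_join_rects ([set z | r < c z] :
    set ((borel X * borel Y) * (borel X * borel Y))).
Proof.
move=> /lower_semicontinuousP /(_ r) oc; apply: open_sigma_join_rects.
by rewrite (_ : [set z | _] = [set z | (r%:E < (EFin \o c) z)%E])//;
  apply/seteqP; split=> z /=; rewrite lte_fin.
Qed.

Variables (mu : probability (borel X) R) (nu : probability (borel Y) R).
Local Notation plan := (probability (borel X * borel Y)%type R).

Lemma limit_coupling (U : set_system plan) : UltraFilter U ->
  U (couplings mu nu) ->
  exists2 pi : plan, couplings mu nu pi &
    forall A B, measurable A -> measurable B ->
      limit_mass (U := U) id (A `*` B) = mass pi (A `*` B).
Proof.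
move=> UU Uc.
have hL := @limit_mass_content _ U UU R _ _ (id : plan -> plan).
have LX A : measurable A ->
    limit_mass (U := U) (id : plan -> plan) (A `*` setT) = mass mu A.
  move=> mA; apply: limit_mass_eq; first exact: measurableX.
  apply: filterS Uc => p [pX _]; congr fine; rewrite -pX// /pushforward.
  by congr (p _); apply/seteqP; split=> -[x y] //= [].
have LY B : measurable B ->
    limit_mass (U := U) (id : plan -> plan) (setT `*` B) = mass nu B.
  move=> mB; apply: limit_mass_eq; first exact: measurableX.
  apply: filterS Uc => p [_ pY]; congr fine; rewrite -pY// /pushforward.
  by congr (p _); apply/seteqP; split=> -[x y] //= [].
have [pi hpi piL] := plan_of_content hX hY hL LX LY.
by exists pi => // A B mA mB; rewrite piL.
Qed.

Lemma product_coupling : couplings mu nu [the probability _ _ of (mu \x nu)%E].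
Proof.
split=> [A mA|B mB]; rewrite /pushforward.
  rewrite -setXT.
  by rewrite /= product_measure1E// [X in (_ * X)%E]probability_setT mule1.
rewrite -setTX.
by rewrite /= product_measure1E// [X in (X * _)%E]probability_setT mul1e.
Qed.

Lemma exists_minimizer (c : (X * Y) * (X * Y) -> R) :
  cost_class mu nu c -> lower_semicontinuous (EFin \o c) ->
  exists pi : plan, minimizer mu nu c pi.
Proof.
move=> hc lscc.
(* The sets of couplings at least as good as a given one are nested, so they form
   the base of a filter. *)
pose better (p : plan) := [set q : plan | couplings mu nu q /\
  (plan_cost q c <= plan_cost p c)%E].
pose F := filter_from (couplings mu nu) better.
have FF : ProperFilter F.
  apply: filter_from_proper; last first.
    by move=> p hp; exists p; split.
  apply: filter_from_filter.
    by exists [the probability _ _ of (mu \x nu)%E]; exact: product_coupling.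
  move=> p q hp hq; have [pq|/ltW qp] := leP (plan_cost p c) (plan_cost q c).
    by exists p => // r [hr rp]; split; split => //; exact: le_trans pq.
  by exists q => // r [hr rq]; split; split => //; exact: le_trans qp.
have [U [UU FU]] := ultraFilterLemma FF.
have Ubetter p : couplings mu nu p -> U (better p).
  by move=> hp; apply: FU; exists p.
have Uc : U (couplings mu nu).
  by apply: filterS (Ubetter _ product_coupling) => p [].
have [pi hpi Upi] := limit_coupling UU Uc.
exists pi; split => // p hp; rewrite leNgt; apply/negP => lt_p.
have [M [pM Mpi]] : exists M : R,
    (plan_cost p c <= M%:E)%E /\ (M%:E < plan_cost pi c)%E.
  case: (plan_cost p c) lt_p => [r||] lt_p.
  - by exists r.
  - by rewrite ltNge leey in lt_p.
  - case: (plan_cost pi c) lt_p => [s||] lt_p.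
    + by exists (s - 1); rewrite leNye lte_fin ltrBlDr ltrDl ltr01.
    + by exists 0; rewrite leNye ltry.
    + by rewrite ltxx in lt_p.
have /filter_ex[q [[_ qp] [_ Mq]]] : U (better p `&`
    [set q | couplings mu nu q /\ (M%:E < plan_cost q c)%E]).
  apply: filterI; first exact: Ubetter.
  apply: (plan_cost_lsc _ UU Uc hpi Upi hc Mpi) => r.
  exact: lsc_superlevel.
by have := le_lt_trans (le_trans qp pM) Mq; rewrite ltxx.
Qed.

End minimizer.

(** * Atomless measures *)

Section atomless_split.
Context {R : realType} {d : measure_display} {Z : measurableType d}.
Variable mu : probability Z R.
Hypothesis mu_atomless : atomless mu.

Let hmu := mass_content mu.

(** One of the two pieces of a nontrivial division is small enough. *)
Lemma atomless_half (A : set Z) : measurable A -> 0 < mass mu A ->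
  exists B : set Z, [/\ measurable B, B `<=` A & 0 < mass mu B <= mass mu A / 2].
Proof.
move=> mA A0; apply: contrapT => nB; apply: mu_atomless; exists A; split => //.
  by rewrite massE.
move=> B mB BA; apply: contrapT => /not_orP[B0 BnA]; apply: nB.
have mAB := measurableD mA mB.
have B_gt0 : 0 < mass mu B.
  rewrite lt_neqAle hmu.1// andbT; apply/eqP => h; apply: B0.
  by rewrite massE// -h.
have B_ltA : mass mu B < mass mu A.
  rewrite lt_neqAle (le_content hmu)// andbT; apply/eqP => h; apply: BnA.
  by rewrite !massE// h.
have [Bh|Bh] := leP (mass mu B) (mass mu A / 2).
  by exists B; rewrite B_gt0 Bh.
exists (A `\` B); split => //.
by rewrite (contentD hmu)//; apply/andP; split; lra.
Qed.

Lemma atomless_small (A : set Z) (e : R) : measurable A -> 0 < mass mu A -> 0 < e ->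
  exists B : set Z, [/\ measurable B, B `<=` A & 0 < mass mu B < e].
Proof.
move=> mA A0 e0.
have pow n : exists B : set Z,
    [/\ measurable B, B `<=` A & 0 < mass mu B <= mass mu A / (2 ^ n)%:R].
  elim: n => [|n [B [mB BA /andP[B0 Bn]]]].
    by exists A; split => //; rewrite A0 expn0 divr1 lexx.
  have [C [mC CB /andP[C0 Cn]]] := atomless_half mB B0.
  exists C; split => //; first exact: subset_trans BA.
  rewrite C0/= expnSr natrM invfM mulrA; apply: le_trans Cn _.
  by rewrite ler_pM2r ?invr_gt0.
have [n hn] := mesh_lt (divr_gt0 e0 A0).
have [B [mB BA /andP[B0 Bn]]] := pow n.
exists B; split => //; rewrite B0/=; apply: le_lt_trans Bn _.
rewrite ltr_pdivlMr// mulrC in hn; apply: le_lt_trans hn.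
rewrite ler_pM2l// /mesh lef_pV2 ?posrE ?ltr0n ?expn_gt0//.
by rewrite ler_nat ltn_expl.
Qed.

(** One greedy step: enlarge [B] by at least half of what can still be added
without exceeding [t]. *)
Lemma greedy_step (A B : set Z) (t : R) :
  measurable A -> measurable B -> mass mu B <= t ->
  exists B' : set Z, [/\ measurable B', B' `<=` B `|` A, B `<=` B',
    mass mu B' <= t &
    forall C, measurable C -> C `<=` A `\` B -> mass mu B + mass mu C <= t ->
      mass mu C <= 2 * (mass mu B' - mass mu B)].
Proof.
move=> mA mB Bt.
pose E := [set r | exists C : set Z, [/\ measurable C, C `<=` A `\` B,
  mass mu B + mass mu C <= t & r = mass mu C]].
have E0 : E 0 by exists set0; split => //; rewrite (content0 hmu) ?addr0.
have supE : has_sup E.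
  split; first by exists 0.
  by exists (t - mass mu B) => r [C [_ _ Ct ->]]; rewrite lerBrDl.
have [r [Er hr]] : exists r, E r /\ sup E <= 2 * r.
  have [s0|s0] := leP (sup E) 0; first by exists 0; rewrite mulr0.
  have [r Er hr] := sup_adherent (divr_gt0 s0 (ltr0n R 2)) supE.
  by exists r; split => //; lra.
case: Er => C [mC CAB Ct rC].
have BC0 : B `&` C = set0.
  by rewrite -subset0 => z [Bz /CAB[]].
exists (B `|` C); split.
- exact: measurableU.
- by move=> z [Bz|/CAB[Az _]]; [left|right].
- exact: subsetUl.
- by rewrite hmu.2.
- move=> C' mC' C'A C't; rewrite hmu.2// [_ + _ - _]addrAC subrr add0r -rC.
  apply: le_trans hr; apply: sup_upper_bound => //.
  by exists C'.
Qed.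

(** Sierpinski's theorem. If the greedy union stopped short of [t], a small set
outside of it could have been added at every step, and each step would have
gained at least half of its mass. *)
Lemma atomless_split (A : set Z) (t : R) : measurable A -> 0 <= t <= mass mu A ->
  exists B : set Z, [/\ measurable B, B `<=` A & mass mu B = t].
Proof.
move=> mA /andP[t0 tA].
pose ok (B : set Z) := [/\ measurable B, B `<=` A & mass mu B <= t].
have step B : exists B', ok B -> [/\ ok B', B `<=` B' &
    forall C, measurable C -> C `<=` A `\` B -> mass mu B + mass mu C <= t ->
      mass mu C <= 2 * (mass mu B' - mass mu B)].
  have [[mB BA Bt]|nok] := pselect (ok B); last by exists set0.
  have [B' [mB' B'A BB' B't h]] := greedy_step mA mB Bt.
  by exists B' => _; split => //; split => // z /B'A[/BA|].
have [f hf] := choice step.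
pose B n := iter n f set0.
have okB n : ok (B n).
  elim: n => [|n IH]; last by case: (hf (B n)).
  by split; [exact: measurable0|exact: sub0set|rewrite (content0 hmu)].
have mB n : measurable (B n) by case: (okB n).
have ndB : nondecreasing_seq B.
  apply/nondecreasing_seqP => n; apply/subsetPset.
  by case: (hf (B n)).
have mU : measurable (\bigcup_n B n) by exact: bigcupT_measurable.
have UA : \bigcup_n B n `<=` A by move=> z [n _]; case: (okB n) => _ h _; exact: h.
have Ut : mass mu (\bigcup_n B n) <= t.
  rewrite leNgt; apply/negP => /(mass_bigcup_gt mB ndB)[n].
  by rewrite ltNge; case: (okB n) => _ _ ->.
exists (\bigcup_n B n); split => //; apply/eqP; rewrite eq_le Ut/= leNgt.
apply/negP => lt_t.
have [|||C [mC CA /andP[C0 Ct]]] := @atomless_small (A `\` \bigcup_n B n)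
    (t - mass mu (\bigcup_n B n)).
- exact: measurableD.
- by rewrite (contentD hmu)//; lra.
- by lra.
have grow n : n%:R * mass mu C <= 2 * mass mu (B n).
  elim: n => [|n IH]; first by rewrite mul0r (content0 hmu) mulr0.
  have [_ _ /(_ C mC _ _)] := hf (B n) (okB n).
  have BnU : B n `<=` \bigcup_n B n by move=> z Bz; exists n.
  have := le_content hmu (mB n) mU BnU => h1 h2.
  have /h2 : C `<=` A `\` B n.
    by move=> z /CA[Az nU]; split => // Bz; apply: nU; exact: BnU.
  have -> : f (B n) = B n.+1 by [].
  have h3 : mass mu (B n) + mass mu C <= t by lra.
  by move=> /(_ h3); rewrite -natr1 mulrDl mul1r; lra.
have T0 : 0 < 2 * t + 1 by lra.
have [n hn] := mesh_lt (divr_gt0 C0 T0).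
have := grow n.+1; case: (okB n.+1) => _ _ Bt h.
rewrite ltr_pdivlMr// /mesh mulrC ltr_pdivrMr// in hn.
lra.
Qed.

End atomless_split.

(** * Nested partitions *)

Section binary_trees.
Context {T : Type}.

(** Nested binary partitions, indexed by the words of bits read from the most
recent choice to the oldest one. *)
Definition splits (t : seq bool -> set T) : Prop := forall s,
  t s = t (true :: s) `|` t (false :: s) /\
  t (true :: s) `&` t (false :: s) = set0.

Variable t : seq bool -> set T.
Hypothesis tP : splits t.

Lemma tree_sub b s : t (b :: s) `<=` t s.
Proof. by rewrite (tP s).1; case: b => x; [left|right]. Qed.

(** The name of the cell of the [n]-th partition that contains [x]. *)
Fixpoint address (x : T) (n : nat) : seq bool :=
  if n is m.+1 then (x \in t (true :: address x m)) :: address x m else [::].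

Lemma size_address x n : size (address x n) = n.
Proof. by elim: n => //= n ->. Qed.

Lemma tree_address x n : t [::] x -> t (address x n) x.
Proof.
move=> tx; elim: n => //= n IH; case: (boolP (x \in t (true :: address x n))).
  by rewrite inE.
by move=> /negP; rewrite inE => nx; move: IH; rewrite (tP _).1 => -[].
Qed.

Lemma tree_root s x : t s x -> t [::] x.
Proof. by elim: s => // b s IH /tree_sub. Qed.

Lemma tree_addressE s x : t s x -> s = address x (size s).
Proof.
elim: s => //= b s IH bx; have sx := tree_sub bx.
rewrite -(IH sx); congr (_ :: _); case: b bx => bx; first by rewrite mem_set.
apply/esym/negbTE/negP; rewrite inE => tx.
by have : (t (true :: s) `&` t (false :: s)) x by []; rewrite (tP s).2.
Qed.

Lemma tree_inj s s' x : size s = size s' -> t s x -> t s' x -> s = s'.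
Proof. by move=> ss' /tree_addressE -> /tree_addressE ->; rewrite ss'. Qed.

Lemma tree_nested s s' x :
  t s x -> t s' x -> (size s <= size s')%N -> t s' `<=` t s.
Proof.
move=> tx; elim: s' => [|b s' IH] s'x.
  by rewrite leqn0 => /eqP/size0nil ->.
rewrite leq_eqVlt => /predU1P[ss'|ss'].
  by rewrite (tree_inj ss' tx s'x).
have s'x' := tree_sub s'x.
by apply: subset_trans (IH s'x' ss'); exact: tree_sub.
Qed.

End binary_trees.

Lemma finite_words n : finite_set [set s : seq bool | size s = n].
Proof.
apply: (@sub_finite_set _ _ (range (@tval n bool))); last first.
  by apply: finite_image; exact: finite_finset.
by move=> s /= /eqP ss; exists (Tuple ss).
Qed.

Lemma countable_bigcup_measurable {d} {Z : measurableType d} {I : countType}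
    (F : I -> set Z) (S : set I) :
  (forall i, measurable (F i)) -> measurable (\bigcup_(i in S) F i).
Proof.
move=> mF; rewrite bigcup_mkcond; apply: countable_bigcupT_measurable => // i.
by case: ifP.
Qed.

Section matched_trees.
Context {R : realType} {d d' : measure_display}.
Context {Z : measurableType d} {W : measurableType d'}.
Variable m : {finite_measure set Z -> \bar R}.
Variable m' : {finite_measure set W -> \bar R}.
Variables (t : seq bool -> set Z) (t' : seq bool -> set W).
Hypotheses (tP : splits t) (tP' : splits t').
Hypotheses (mt : forall s, measurable (t s)) (mt' : forall s, measurable (t' s)).

Lemma matched_trees (n : nat) (S : set (seq bool)) :
  (forall s, mass m (t s) = mass m' (t' s)) ->
  mass m (\bigcup_(s in [set s | size s = n /\ S s]) t s) =
  mass m' (\bigcup_(s in [set s | size s = n /\ S s]) t' s).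
Proof.
move=> tt'; set D := [set s | _].
have finD : finite_set D.
  by apply: sub_finite_set (finite_words n) => s [].
have triv T (u : seq bool -> set T) : splits u -> trivIset D u.
  move=> uP s s' [sn _] [s'n _] [x [us us']].
  by apply: (tree_inj uP _ us us'); rewrite sn.
congr fine; rewrite !measure_fin_bigcup//; try exact: triv.
apply: eq_fsbigr => s _; transitivity (mass m (t s))%:E; first exact: massE.
by rewrite tt'; apply/esym; exact: massE.
Qed.

End matched_trees.

Section cells.
Context {T : Type} (V : nat -> set T).

Fixpoint cell (s : seq bool) : set T :=
  if s is b :: s' then
    cell s' `&` (if b then V (size s') else ~` V (size s'))
  else setT.

Lemma cell_splits : splits cell.
Proof.
move=> s /=; split; first by rewrite -setIUr setUCr setIT.
by rewrite setIACA setICr setI0.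
Qed.

(** The [i]-th bit of [s], counted from the oldest one, tells on which side of
[V i] the cell lies. *)
Lemma cell_sub s i x : cell s x -> (i < size s)%N -> V i x -> cell s `<=` V i.
Proof.
elim: s => //= b s IH [sx bx]; rewrite ltnS leq_eqVlt => /predU1P[->|lt_i].
  by case: b bx => // bx Vx y [].
by move=> Vx y [sy _]; exact: (IH sx lt_i Vx).
Qed.

End cells.

Lemma measurable_cell {d} {Z : measurableType d} (V : nat -> set Z) s :
  (forall n, measurable (V n)) -> measurable (cell V s).
Proof.
move=> mV; elim: s => //= b s IH; apply: measurableI => //.
by case: b => //; exact: measurableC.
Qed.

Section transport_tree.
Context {R : realType} {d d' : measure_display}.
Context {Z : measurableType d} {W : measurableType d'}.
Variable mu : probability Z R.
Hypothesis mu_atomless : atomless mu.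
Variable rho : {finite_measure set W -> \bar R}.
Variable t' : seq bool -> set W.
Hypotheses (tP' : splits t') (mt' : forall s, measurable (t' s)).

(** Each cell is divided in the proportion that the given tree prescribes. *)
Lemma imitate_tree (A : set Z) : measurable A -> mass mu A = mass rho (t' [::]) ->
  exists t : seq bool -> set Z, [/\ splits t, t [::] = A,
    forall s, measurable (t s) & forall s, mass mu (t s) = mass rho (t' s)].
Proof.
move=> mA Arho; have hrho := mass_content rho; have hmu := mass_content mu.
have hsplit (Br : set Z * R) : exists C : set Z,
    measurable Br.1 -> 0 <= Br.2 <= mass mu Br.1 ->
    [/\ measurable C, C `<=` Br.1 & mass mu C = Br.2].
  have [[mB Bt]|h] := pselect (measurable Br.1 /\ 0 <= Br.2 <= mass mu Br.1).
    by have [C hC] := atomless_split mu_atomless mB Bt; exists C.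
  by exists set0 => mB Bt; exfalso; exact: h.
have [f hf] := choice hsplit.
pose sp B s := f (B, mass rho (t' (true :: s))).
pose t := fix t (s : seq bool) : set Z := if s is b :: s' then
  (if b then sp (t s') s' else t s' `\` sp (t s') s') else A.
have t'sub s : t' (true :: s) `<=` t' s by exact: tree_sub.
have ht s : measurable (t s) /\ mass mu (t s) = mass rho (t' s).
  elim: s => // b s [ms es].
  have [mC CA eC] := hf (t s, mass rho (t' (true :: s))) ms
    (introT andP (conj (hrho.1 _ (mt' _))
      (eq_ind_r (fun r => _ <= r) (le_content hrho (mt' _) (mt' _) (t'sub s)) es))).
  case: b => //=; split; first exact: measurableD.
  rewrite (contentD hmu)//= eC es (tP' s).1 hrho.2// ?(tP' s).2//.
  by rewrite /= addrAC subrr add0r.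
have sps s : sp (t s) s `<=` t s.
  have [ms es] := ht s; have [||_ h _] := hf (t s, mass rho (t' (true :: s))) => //=.
  by rewrite hrho.1//= es; apply: (le_content hrho).
exists t; split => // [s|s|s]; [|by case: (ht s)|by case: (ht s)].
split => /=; first by rewrite setDUK.
by rewrite setDE setICA setICr setI0.
Qed.

End transport_tree.

(** * Transport onto a compact Polish space *)

Section compact_polish.
Context {R : realType} {Y : ptopologicalType}.
Hypotheses (hY : polish R Y) (compY : compact [set: Y]).

(** The balls around a dense sequence, in one sequence: by compactness an initial
segment already covers [Y] with balls of a given size. *)
Lemma fine_cover : exists2 dist : Y -> Y -> R, complete_compatible_metric dist &
  exists2 V : nat -> set Y, forall n, open (V n) &
  forall e : R, 0 < e -> exists n, forall y, exists i,
    [/\ (i < n)%N, V i y & forall u v, V i u -> V i v -> dist u v < e].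
Proof.
have [sepY [dist hd]] := hY; have [s hs] := separable_seq sepY.
exists dist => //; exists (ball_seq (dist := dist) s); first exact: ball_seq_open.
move=> e e0; have [k hk] := mesh_lt (divr_gt0 e0 (ltr0n R 2)).
have := compY; rewrite compact_cover.
move=> /(_ nat setT (fun j => oball (dist := dist) (s j) (mesh k))) [|y _|D _ Dcov].
- by move=> j _; exact: open_oball.
- by have [j hj] := cover_balls hd hs k y; exists j.
have [r rD] := (finite_seqP _).1 (finite_fset D); rewrite {}rD in Dcov.
exists (\max_(j <- r) pickle (j, k)).+1 => y.
have [j /= jr jy] := Dcov y I; exists (pickle (j, k)); split.
- by rewrite ltnS (big_rem j)//= leq_maxl.
- by rewrite /ball_seq pickleK.
rewrite /ball_seq pickleK /oball /= => u v su sv.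
have [_ distC tri _ _] := hd.
have := tri u (s j) v; rewrite (distC u (s j)); lra.
Qed.

End compact_polish.

Section transport_onto.
Context {R : realType} {d : measure_display} {Z : measurableType d}.
Context {Y : ptopologicalType}.
Hypotheses (hY : polish R Y) (compY : compact [set: Y]).
Variable mu : probability Z R.
Hypothesis mu_atomless : atomless mu.

(** Cut [Y] into cells of vanishing diameter and [A] into cells of the same
masses; sending a point of [A] to the limit of the cells of [Y] with the same
names moves it, up to a null set, to the right place within any precision. *)
Lemma transport_onto (A : set Z) (rho : {finite_measure set (borel Y) -> \bar R}) :
  measurable A -> mass mu A = mass rho setT ->
  exists T : Z -> borel Y, measurable_fun setT T /\
    forall B, measurable B -> mass mu (A `&` T @^-1` B) = mass rho B.
Proof.
move=> mA Arho.
have [dist hd [V oV fineV]] := fine_cover hY compY.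
have [_ distC tri _ _] := hd.
have mV n : measurable (V n : set (borel Y)) by exact: open_borel.
pose c : seq bool -> set (borel Y) := cell V.
have mc s : measurable (c s) by exact: measurable_cell.
have cP : splits c := cell_splits V.
have [t [tP tA mt et]] := imitate_tree mu_atomless cP mc mA Arho.
have hmu := mass_content mu; have hrho := mass_content rho.
(* Points of [A] whose cell in [Y] is empty at some level. *)
pose N := \bigcup_(s in [set s | c s = set0]) t s.
have mN : measurable N by exact: countable_bigcup_measurable.
have N0 : mass mu N = 0.
  pose Nn n := \bigcup_(s in [set s | size s = n /\ c s = set0]) t s.
  have mNn n : measurable (Nn n) by exact: countable_bigcup_measurable.
  have Nn0 n : mass mu (Nn n) = 0.
    rewrite (matched_trees tP cP mt mc n (fun s => c s = set0) et).
    rewrite (_ : \bigcup_(s in _) c s = set0) ?(content0 hrho)//.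
    by rewrite -subset0 => y [s [_ ->]].
  have -> : N = \bigcup_n Nn n.
    by apply/seteqP; split=> [x [s cs ts]|x [n _ [s [_ cs] ts]]];
      [exists (size s) => //; exists s|exists s].
  apply/eqP; rewrite eq_le hmu.1; last exact: bigcupT_measurable.
  rewrite andbT; apply/ler_addgt0Pl => e e0; rewrite addr0.
  by apply: mass_bigcup_small => // [|n]; rewrite ?Nn0 ?divr_ge0// ltW.
pose pt s : Y := xget point (c s).
have ptP s : c s !=set0 -> c s (pt s).
  by move=> [y cy]; rewrite /pt; case: xgetP => [z -> //|/(_ y)].
have good_cell x n : A x -> ~ N x -> c (address t x n) !=set0.
  move=> Ax nNx; apply/set0P/eqP => c0; apply: nNx; exists (address t x n) => //.
  by apply: (tree_address tP); rewrite tA.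
have small e : 0 < e -> exists n, forall s, (n <= size s)%N ->
    forall u v, c s u -> c s v -> dist u v < e.
  move=> /fineV[n hn]; exists n => s ns u v cu cv.
  have [i [lt_i Vu dV]] := hn u.
  have csV := cell_sub cu (leq_trans lt_i ns) Vu.
  by apply: dV; exact: csV.
have address_sub x n m : (n <= m)%N -> c (address t x m) `<=` c (address t x n).
  elim: m => [|m IH]; first by rewrite leqn0 => /eqP ->.
  rewrite leq_eqVlt => /predU1P[->//|nm]; apply: subset_trans (IH nm) => /=.
  exact: tree_sub.
have pt_close e : 0 < e -> exists n, forall x, A x -> ~ N x ->
    forall i j, (n <= i)%N -> (n <= j)%N ->
    dist (pt (address t x i)) (pt (address t x j)) < e.
  move=> /small[n hn]; exists n => x Ax nNx i j ni nj.
  apply: (hn (address t x n)); first by rewrite size_address.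
    by apply: (address_sub _ _ _ ni); apply: ptP; exact: good_cell.
  by apply: (address_sub _ _ _ nj); apply: ptP; exact: good_cell.
have limT x : exists y : Y, A x -> ~ N x -> pt (address t x n) @[n --> \oo] --> y.
  have [[Ax nNx]|h] := pselect (A x /\ ~ N x); last first.
    by exists point => Ax nNx; exfalso; exact: h.
  have [_ _ _ _ complete_dist] := hd.
  have [|y hy] := complete_dist (fun n => pt (address t x n)); last by exists y.
  by move=> e /pt_close[n hn]; exists n; exact: hn.
have [T0 hT0] := choice limT.
pose T x := if pselect (A x /\ ~ N x) then T0 x else point.
have T_close e : 0 < e -> exists n, forall x, A x -> ~ N x ->
    forall i, (n <= i)%N -> dist (T x) (pt (address t x i)) < e.
  move=> e0; have [n hn] := pt_close (e / 2) ltac:(lra).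
  exists n => x Ax nNx i ni; rewrite /T; case: pselect => [?|[]//].
  have /(hT0 x Ax nNx)[k _ hk] : nbhs (T0 x) (oball (dist := dist) (T0 x) (e / 2)).
    by apply/(nbhs_dist hd); exists (e / 2) => //; lra.
  have := hk (maxn n k) (leq_maxr _ _); rewrite /oball /= => h1.
  have := hn x Ax nNx (maxn n k) i (leq_maxl _ _) ni.
  have := tri (T0 x) (pt (address t x (maxn n k))) (pt (address t x i)); lra.
(* The map to the chosen point of the [n]-th cell takes countably many values. *)
have maddress (S : set Y) n : measurable (A `&` [set x | S (pt (address t x n))]).
  rewrite (_ : _ `&` _ = \bigcup_(s in [set s | size s = n /\ S (pt s)]) t s).
    exact: countable_bigcup_measurable.
  apply/seteqP; split=> [x [Ax Sx]|x [s [/= sn Ss] ts]].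
    exists (address t x n); first by rewrite /= size_address.
    by apply: (tree_address tP); rewrite tA.
  split; first by rewrite -tA; exact: (tree_root tP ts).
  by rewrite /= -sn -(tree_addressE tP ts).
have mgood : measurable (A `\` N) by exact: measurableD.
have mT : measurable_fun setT (T : Z -> borel Y).
  have bE : @measurable _ (borel Y) = <<s @open Y >> by [].
  apply: (measurability _ bE) => _ [D oD <-]; rewrite setTI.
  have mesh2 k : 0 < (mesh k / 2 : R) by have := @mesh_gt0 R k; lra.
  have [n hn] := choice (fun k => T_close _ (mesh2 k)).
  pose D_ k := [set y | oball (dist := dist) y (mesh k) `<=` D].
  rewrite (_ : T @^-1` D =
    ((A `\` N) `&` \bigcup_k (A `&` [set x | D_ k (pt (address t x (n k)))])) `|`
    (~` (A `\` N) `&` [set _ | D point])).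
    apply: measurableU; apply: measurableI => //.
    - by apply: bigcupT_measurable => k; exact: maddress.
    - exact: measurableC.
    - have [Dp|nDp] := pselect (D point).
        by rewrite (_ : [set _ | _] = setT)//; apply/seteqP; split.
      by rewrite (_ : [set _ | _] = set0)//; apply/seteqP; split.
  apply/seteqP; split=> x /=.
    have [[Ax nNx] Dx|bad] := pselect (A x /\ ~ N x); last first.
      by rewrite {1}/T; case: pselect => // ? Dp; right; split => // -[].
    left; split => //; have [e e0 eD] := dist_open hd oD Dx.
    have [k hk] := mesh_lt (divr_gt0 e0 (ltr0n R 2)).
    exists k => //; split => // y.
    rewrite /oball /= => yk; apply: eD; rewrite /oball /=.
    have := hn k x Ax nNx (n k) (leqnn _); have := @mesh_gt0 R k.
    have := tri (T x) (pt (address t x (n k))) y; lra.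
  move=> [[[Ax nNx] [k _ [_ Dk]]]|[bad Dp]].
    apply: Dk; rewrite /oball /= distC.
    by have := hn k x Ax nNx (n k) (leqnn _); have := @mesh_gt0 R k; lra.
  by rewrite /T; case: pselect.
have mTD (D : set (borel Y)) : measurable D -> measurable (A `&` T @^-1` D).
  by move=> mD; apply: measurableI => //; exact: (preimage_measurable mT).
have level (S : set (seq bool)) n :
    measurable (\bigcup_(s in [set s | size s = n /\ S s]) t s) /\
    measurable (\bigcup_(s in [set s | size s = n /\ S s]) c s).
  by split; exact: countable_bigcup_measurable.
(* [T x] is close to every point of the cell of [Y] that has the address of [x], so
   the image of [mu] and [rho] are at Levy-Prokhorov distance [0]. *)
have upper (C D : set (borel Y)) e : 0 < e -> measurable C -> measurable D ->
    thicken (dist := dist) C e `<=` D ->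
    mass mu (A `&` T @^-1` C) <= mass rho D.
  move=> e0 mC mD CD; have e20 : 0 < e / 2 by lra.
  have [n1 hn1] := T_close _ e20; have [n2 hn2] := small _ e20.
  pose n := maxn n1 n2; have [mSt mSc] := level (fun s => c s `<=` D) n.
  apply: (@le_trans _ _ (mass mu (N `|`
      \bigcup_(s in [set s | size s = n /\ c s `<=` D]) t s))).
    apply: (le_content hmu); [exact: mTD|exact: measurableU|].
    move=> x [Ax Cx]; have [Nx|nNx] := pselect (N x); first by left.
    right; exists (address t x n); last by apply: (tree_address tP); rewrite tA.
    split; first exact: size_address.
    move=> y cy; apply: CD; exists (T x) => //.
    have := hn1 x Ax nNx n (leq_maxl _ _).
    have := hn2 (address t x n) _ (pt (address t x n)) y
      (ptP _ (good_cell _ _ Ax nNx)) cy.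
    rewrite size_address => /(_ (leq_maxr _ _)).
    have := tri (T x) (pt (address t x n)) y; lra.
  apply: le_trans (contentU_le hmu mN mSt) _.
  rewrite N0 add0r (matched_trees tP cP mt mc n (fun s => c s `<=` D) et).
  by apply: (le_content hrho) => // y [s [_ sD] /sD].
have lower (C D : set (borel Y)) e : 0 < e -> measurable C -> measurable D ->
    thicken (dist := dist) C e `<=` D ->
    mass rho C <= mass mu (A `&` T @^-1` D).
  move=> e0 mC mD CD; have e20 : 0 < e / 2 by lra.
  have [n1 hn1] := T_close _ e20; have [n2 hn2] := small _ e20.
  pose n := maxn n1 n2; have [mSt mSc] := level (fun s => c s `&` C !=set0) n.
  apply: (@le_trans _ _ (mass rho
      (\bigcup_(s in [set s | size s = n /\ c s `&` C !=set0]) c s))).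
    apply: (le_content hrho) => // y Cy.
    exists (address c y n); last exact: (tree_address cP).
    split; first exact: size_address.
    by exists y; split => //; exact: (tree_address cP).
  rewrite -(matched_trees tP cP mt mc n (fun s => c s `&` C !=set0) et).
  apply: (@le_trans _ _ (mass mu (N `|` (A `&` T @^-1` D)))); last first.
    by apply: le_trans (contentU_le hmu mN (mTD _ mD)) _; rewrite N0 add0r.
  apply: (le_content hmu) => //; first by apply: measurableU => //; exact: mTD.
  move=> x [s [sn [y [cy Cy]]] ts]; have [Nx|nNx] := pselect (N x); first by left.
  have Ax : A x by rewrite -tA; exact: (tree_root tP ts).
  right; split => //; apply: CD; exists y => //.
  have := hn1 x Ax nNx n (leq_maxl _ _).
  have ptc : c s (pt s) by apply: ptP; exists y.
  have := hn2 s _ y (pt s) cy ptc.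
  rewrite sn => /(_ (leq_maxr _ _)); rewrite -sn -(tree_addressE tP ts).
  have := tri y (pt s) (T x); rewrite (distC (pt s)); lra.
(* A closed set is the intersection of its open neighborhoods, to which [upper] and
   [lower] apply. *)
have closed_eq (C : set Y) : closed C ->
    mass mu (A `&` T @^-1` C) = mass rho (C : set (borel Y)).
  move=> cC; have mC := closed_borel cC.
  pose D k : set (borel Y) := thicken (dist := dist) C (mesh k).
  have mD k : measurable (D k) by apply: open_borel; exact: open_thicken.
  have niD : nonincreasing_seq D.
    by move=> i j ij; apply/subsetPset; apply: thicken_mono; exact: mesh_le.
  have capD : \bigcap_k D k = C := bigcap_thicken hd cC.
  apply/eqP; rewrite eq_le; apply/andP; split; rewrite leNgt; apply/negP.
    rewrite -{1}capD => /(mass_bigcap_lt mD niD)[k].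
    by rewrite ltNge (upper _ _ (mesh k))//; exact: mesh_gt0.
  have -> : A `&` T @^-1` C = \bigcap_k (A `&` T @^-1` (D k)).
    rewrite -capD preimage_bigcap; apply/seteqP; split=> x.
      by move=> [Ax Dx] k _; split => //; exact: Dx.
    by move=> h; split; [case: (h 0 I)|move=> k _; case: (h k I)].
  move=> /mass_bigcap_lt[|i j ij|k].
  - by move=> k; exact: mTD.
  - apply/subsetPset; apply: setIS; apply: preimage_subset.
    by apply/subsetPset; exact: niD.
  - by rewrite ltNge (lower _ _ (mesh k))//; exact: mesh_gt0.
have [m1 m1E] := image_measure [the measure _ _ of mrestr mu mA] mT.
have m1mass D : measurable D -> m1 D = (mass mu (A `&` T @^-1` D))%:E.
  by move=> mD; rewrite m1E /= /mrestr setIC massE//; exact: mTD.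
exists T; split => // B mB; apply: EFin_inj; rewrite -m1mass// -massE//.
have bE : @measurable _ (borel Y) = <<s @open Y >> by [].
apply: (@measure_unique _ _ (borel Y) (@open Y) (fun=> setT) bE _ _ _ m1 rho) => //.
- by move=> C D oC oD; exact: openI.
- by move=> _; exact: openT.
- by apply/seteqP; split=> // y _; exists 0.
- move=> D oD; have mD := open_borel oD.
  have mCD : measurable (~` D : set (borel Y)) by exact: measurableC.
  have := closed_eq _ (open_closedC oD).
  have -> : A `&` T @^-1` (~` D) = A `\` (A `&` T @^-1` D).
    by rewrite setDIr setDv set0U preimage_setC setDE.
  rewrite (contentD hmu mA (mTD _ mD)); last exact: subIsetl.
  rewrite -setTD (contentD hrho)// Arho => eqD.
  rewrite m1mass//; transitivity (mass rho D)%:E; last by rewrite -massE.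
  by congr EFin; lra.
- by move=> _; rewrite m1mass// ltry.
Qed.

End transport_onto.

(** * Transport maps close to a coupling *)

Section finite_mass.
Context {d : measure_display} {Z : measurableType d} {R : realType}.
Variable m : {measure set Z -> \bar R}.
Hypothesis m_fin : fin_num_fun m.

(** A copy of [m] whose type records that it is finite. *)
Definition finite_mass (_ : fin_num_fun m) : set Z -> \bar R := m.

HB.instance Definition _ := Measure.on (finite_mass m_fin).
HB.instance Definition _ := Measure_isFinite.Build _ _ _ (finite_mass m_fin) m_fin.

End finite_mass.

Section graphs.
Context {R : realType} {dX dY : measure_display}.
Context {X : measurableType dX} {Y : measurableType dY}.

Lemma slab_measure (pi : probability (X * Y)%type R) (A : set X) : measurable A ->
  exists rho : {finite_measure set Y -> \bar R},
    forall B, measurable B -> mass rho B = mass pi (A `*` B).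
Proof.
move=> mA; have mAT : measurable (A `*` setT : set (X * Y)) by exact: measurableX.
have [m hm] := image_measure [the measure _ _ of mrestr pi mAT]
  (@measurable_snd _ _ X Y).
have mE B : m B = pi (A `*` B).
  rewrite hm /= /mrestr; congr (pi _).
  by apply/seteqP; split=> -[x y] /=; [move=> [? []]|move=> []].
have m_fin : fin_num_fun m.
  by move=> B mB; rewrite mE fin_num_measure//; exact: measurableX.
pose rho : {finite_measure set Y -> \bar R} := finite_mass m_fin.
exists rho => B mB.
by rewrite /mass/= /finite_mass mE.
Qed.

(** The coupling concentrated on the graph of a transport map. *)
Lemma graph_plan (mu : probability X R) (T : X -> Y) : measurable_fun setT T ->
  exists2 p : probability (X * Y)%type R,
    forall A B, measurable A -> measurable B ->
      p (A `*` B) = mu (A `&` T @^-1` B) &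
    forall c : (X * Y) * (X * Y) -> R,
      (square p).-integrable setT (EFin \o c) -> plan_cost p c = map_cost mu c T.
Proof.
move=> mT; pose g x := (x, T x).
have mg : measurable_fun setT g by apply: measurable_fun_pair.
have [m hm] := image_measure mu mg.
have mT1 : m setT = 1%E by rewrite hm preimage_setT; exact: probability_setT.
pose p : probability (X * Y)%type R := unit_mass mT1.
exists p => [A B mA mB|c ic]; first by rewrite /p /= /unit_mass hm.
have mgg : measurable_fun setT (fun z : X * X => (g z.1, g z.2)).
  by apply: measurable_fun_pair; apply: measurableT_comp.
have gp A : measurable A -> mu (g @^-1` A) = p A.
  by move=> mA; rewrite /p /= /unit_mass hm.
exact/esym/(integral_image mgg (square_image mg gp) ic).
Qed.

Lemma graph_coupling (mu : probability X R) (nu : probability Y R) (T : X -> Y)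
    (p : probability (X * Y)%type R) :
  (forall A B, measurable A -> measurable B ->
    p (A `*` B) = mu (A `&` T @^-1` B)) ->
  transport_maps mu nu T -> couplings mu nu p.
Proof.
move=> pE [mT Tnu]; split=> [A mA|B mB]; rewrite /pushforward.
  rewrite -setXT.
  by rewrite pE// preimage_setT setIT.
rewrite -setTX.
by rewrite pE// setTI; exact: Tnu.
Qed.

End graphs.

Section approximating_maps.
Context {R : realType} {X Y : ptopologicalType}.
Hypotheses (hY : polish R Y) (compY : compact [set: Y]).
Variables (mu : probability (borel X) R) (nu : probability (borel Y) R).
Hypothesis mu_atomless : atomless mu.
Variable pi : probability (borel X * borel Y)%type R.
Hypothesis hpi : couplings mu nu pi.
Variable V : nat -> set X.
Hypothesis oV : forall n, open (V n).
Hypothesis baseV : forall (O : set X) x, open O -> O x ->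
  exists2 n, V n x & V n `<=` O.

Local Notation xcell := (cell V : seq bool -> set (borel X)).

Let mcell s : measurable (xcell s).
Proof. by apply: measurable_cell => n; exact: open_borel. Qed.

Let cellP : splits xcell := cell_splits V.

(** Two cells are nested or disjoint; the empty set is added for the latter case. *)
Definition cells : set (set (borel X)) :=
  [set S | S = set0 \/ exists s, S = xcell s].

Lemma cellsI : setI_closed cells.
Proof.
move=> A B [->|[s ->]]; first by rewrite set0I; left.
move=> [->|[s' ->]]; first by rewrite setI0; left.
have [->|/set0P[x [sx s'x]]] := eqVneq (xcell s `&` xcell s') set0; first by left.
right; have [ss'|/ltnW s's] := leqP (size s) (size s').
  by exists s'; apply/setIidPr; exact: (tree_nested cellP sx s'x).
by exists s; apply/setIidPl; exact: (tree_nested cellP s'x sx).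
Qed.

Lemma cells_generate : @measurable _ (borel X) = <<s cells >>.
Proof.
apply/seteqP; split; last first.
  apply: smallest_sub; first exact: sigma_algebra_measurable.
  by move=> _ [->|[s ->]]; [exact: measurable0|exact: mcell].
apply: smallest_sub; first exact: smallest_sigma_algebra.
pose E := g_sigma_algebraType cells.
have Ecell s : measurable (xcell s : set E).
  by apply: sub_sigma_algebra; right; exists s.
have EV i : measurable (V i : set E).
  rewrite (_ : V i =
    \bigcup_(s in [set s | size s = i]) (xcell (true :: s) : set E)).
    exact: countable_bigcup_measurable.
  apply/seteqP; split=> [x Vx|x [s /= <- []]//].
  exists (address xcell x i); first by rewrite /= size_address.
  by split; [exact: (tree_address cellP)|rewrite size_address].
move=> O oO; rewrite -[_ O]/(measurable (O : set E)).
rewrite (_ : O = \bigcup_(i in [set i | V i `<=` O]) (V i : set E)).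
  by apply: bigcup_measurable => i _; exact: EV.
apply/seteqP; split=> [x Ox|x [i /= VO Vx]]; last exact: VO.
by have [i Vx VO] := baseV oO Ox; exists i.
Qed.

(** On each cell of the [n]-th partition of [X], transport the mass that [pi]
puts in the slab above that cell; coarser cells are unions of such cells. *)
Lemma approximating_map n : exists T : borel X -> borel Y,
  transport_maps mu nu T /\
  forall s, (size s <= n)%N -> forall B, measurable B ->
    mass mu (xcell s `&` T @^-1` B) = mass pi (xcell s `*` B).
Proof.
have hmu := mass_content mu; have hpi' := mass_content pi.
have piX A : measurable A -> mass pi (A `*` setT) = mass mu A.
  move=> mA; congr fine; rewrite -(hpi.1 _ mA) /pushforward; congr (pi _).
  by apply/seteqP; split=> -[x y] //= [].
have cell_map s : exists T : borel X -> borel Y, measurable_fun setT T /\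
    forall B, measurable B ->
      mass mu (xcell s `&` T @^-1` B) = mass pi (xcell s `*` B).
  have [rho hrho] := slab_measure pi (mcell s).
  have [|T [mT hT]] := transport_onto hY compY mu_atomless (rho := rho) (mcell s).
    by rewrite hrho// piX.
  by exists T; split => // B mB; rewrite hT// hrho.
have [T_ hT] := choice cell_map.
pose T x := T_ (address xcell x n) x.
have T_cell s B : size s = n -> xcell s `&` T @^-1` B = xcell s `&` T_ s @^-1` B.
  move=> sn; apply/seteqP; split=> x [sx /=];
    by rewrite /T -sn -(tree_addressE cellP sx); split.
have mT : measurable_fun setT T.
  move=> _ B mB; rewrite setTI.
  rewrite (_ : T @^-1` B =
    \bigcup_(s in [set s | size s = n]) (xcell s `&` T_ s @^-1` B)).
    apply: countable_bigcup_measurable => s; apply: measurableI => //.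
    exact: (preimage_measurable (hT s).1).
  apply/seteqP; split=> [x Tx|x [s /= sn] sTx]; last first.
    by have [] : (xcell s `&` T @^-1` B) x by rewrite T_cell.
  exists (address xcell x n); first by rewrite /= size_address.
  by split; [exact: (tree_address cellP)|].
have mTB (B : set (borel Y)) : measurable B -> measurable (T @^-1` B).
  by move=> mB; exact: (preimage_measurable mT).
have matched s : (size s <= n)%N -> forall B, measurable B ->
    mass mu (xcell s `&` T @^-1` B) = mass pi (xcell s `*` B).
  move=> sn B mB; have [k sk] : exists k, (size s + k)%N = n.
    by exists (n - size s)%N; rewrite subnKC.
  elim: k s sk {sn} => [|k IH] s sk.
    by rewrite T_cell ?(hT s).2// -sk addn0.
  have mI b : measurable (xcell (b :: s) `&` T @^-1` B).
    by apply: measurableI; [exact: mcell|exact: mTB].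
  have mX b : measurable (xcell (b :: s) `*` B).
    by apply: measurableX => //; exact: mcell.
  have cXU : xcell s `*` B = xcell (true :: s) `*` B `|` xcell (false :: s) `*` B.
    rewrite (cellP s).1; apply/seteqP; split=> -[x y] /=.
      by move=> [[sx|sx] By]; [left|right].
    by move=> [[sx By]|[sx By]]; split => //; [left|right].
  rewrite cXU (cellP s).1 setIUl hmu.2//; last first.
    by rewrite setIACA (cellP s).2 set0I.
  rewrite hpi'.2//; last by rewrite -setXI (cellP s).2 set0X.
  by rewrite !IH//= addSnnS.
exists T; split => //; split => // B mB.
have := matched [::] isT B mB; rewrite /= setTI => TB.
rewrite /pushforward massE; last exact: mTB.
rewrite TB -massE; last exact: measurableX.
rewrite -(hpi.2 _ mB) /pushforward; congr (pi _).
by apply/seteqP; split=> -[x y] //= [].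
Qed.

End approximating_maps.

(** * Continuous costs *)

Section continuous_cost.
Context {R : realType} {X Y : ptopologicalType}.
Variables (mu : probability (borel X) R) (nu : probability (borel Y) R).
Variable c : (X * Y) * (X * Y) -> R.
Hypotheses (mc : measurable_fun
  (setT : set ((borel X * borel Y) * (borel X * borel Y))) c).
Hypotheses (cc : continuous c) (compX : compact [set: X]) (compY : compact [set: Y]).

Lemma continuous_cost_bounded : exists M : R, forall z, `|c z| <= M.
Proof.
have compZ : compact [set: (X * Y) * (X * Y)].
  by rewrite -!setXTT; apply: compact_setX; apply: compact_setX.
have cT : {within setT, continuous c} by exact: continuous_subspaceT.
have [M [_ hM]] := compact_bounded (continuous_compact cT compZ).
by exists (M + 1) => z; apply: (hM (M + 1)); [rewrite ltrDl|exists z].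
Qed.

Local Notation plan := (probability (borel X * borel Y)%type R).

Lemma continuous_cost_integrable (p : plan) :
  (square p).-integrable setT (EFin \o c).
Proof.
have [M hM] := continuous_cost_bounded.
apply: measurable_bounded_integrable => //.
  by apply: le_lt_trans (probability_le1 _ _) (ltry 1).
exists M; split; first exact: num_real.
by move=> x Mx z _; exact: le_trans (hM z) (ltW Mx).
Qed.

Lemma plan_costN (p : plan) : plan_cost p (fun z => - c z) = (- plan_cost p c)%E.
Proof.
rewrite /plan_cost -integralN; first by apply: eq_integral => z _; rewrite EFinN.
exact: integrable_add_def (continuous_cost_integrable p).
Qed.

Lemma continuous_costN_lsc : lower_semicontinuous (EFin \o (fun z => - c z)).
Proof.
apply/lower_semicontinuousP => a.
rewrite (_ : [set z | _] = c @^-1` [set r | r < - a]).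
  by apply: open_comp => [z _|]; [exact: cc|exact: open_lt].
by apply/seteqP; split=> z /=; rewrite lte_fin ltrNr.
Qed.

Lemma continuous_costN_class : cost_class mu nu (fun z => - c z).
Proof.
have [M hM] := continuous_cost_bounded; split.
  exact: measurableT_comp.
exists (cst (- M)), (cst 0); split.
- exact: (finite_measure_integrable_cst (square mu)).
- exact: (finite_measure_integrable_cst (square nu)).
- move=> x y x' y'; rewrite /= addr0 lerN2; apply: le_trans (hM _).
  exact: ler_norm.
Qed.

(** The plans carried by the graphs of the approximating maps converge to [pi] on
rectangles, as they eventually have the right mass above each cell of [X]; lower
semicontinuity for [- c] then bounds their cost from above. *)
Lemma approximate_cost (hX : polish R X) (hY : polish R Y) (pi : plan) (a : R) :
  atomless mu -> couplings mu nu pi -> (plan_cost pi c < a%:E)%E ->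
  exists2 T : borel X -> borel Y, transport_maps mu nu T &
    (map_cost (Y := borel Y) mu c T < a%:E)%E.
Proof.
move=> mu_atomless hpi pia.
have [V [oV baseV]] := polish_base hX.
have [T hT] := choice (approximating_map hY compY mu_atomless hpi oV).
have hp n : exists p : plan, [/\ couplings mu nu p,
    (forall A B, measurable A -> measurable B ->
      p (A `*` B) = mu (A `&` T n @^-1` B)) &
    plan_cost p c = map_cost (Y := borel Y) mu c (T n)].
  have [tT _] := hT n; have [p pE pc] := graph_plan mu tT.1.
  exists p; split => //; first exact: graph_coupling pE tT.
  by apply: pc; exact: continuous_cost_integrable.
have [p hp'] := choice hp.
have [U [UU pU]] := ultraFilterLemma (fmap_proper_filter p eventually_filter).
have Up (S : set plan) : (forall n, S (p n)) -> U S.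
  by move=> hS; apply: pU; exists 0 => // n _; exact: hS.
have Uc : U (couplings mu nu) by apply: Up => n; case: (hp' n).
have hL := @limit_mass_content _ U UU R _ _ (id : plan -> plan).
have mST (B : set (borel Y)) : measurable B ->
  measurable (snd @^-1` B : set (borel X * borel Y)).
  by move=> mB; exact: (preimage_measurable measurable_snd).
have rectE (A : set (borel X)) (B : set (borel Y)) :
  A `*` B = fst @^-1` A `&` snd @^-1` B by [].
have Upi A B : measurable A -> measurable B ->
    limit_mass (U := U) (id : plan -> plan) (A `*` B) = mass pi (A `*` B).
  move=> mA mB; rewrite rectE; move: A mA.
  apply: (content_unique (lam := mu) (G := cells V) hL measurable_fst) => //.
  - move=> A mA; apply: limit_mass_eq.
      exact: (preimage_measurable measurable_fst).
    by apply: filterS Uc => q [qX _]; congr fine; exact: qX.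
  - by move=> A mA; congr fine; exact: hpi.1.
  - exact: mST.
  - exact: cells_generate.
  - exact: cellsI.
  - apply: limit_mass_eq; first exact: mST.
    apply: filterS Uc => q [_ qY]; congr fine.
    by transitivity (nu B); [exact: qY|exact/esym/hpi.2].
  move=> _ [->|[s ->]].
    by rewrite preimage_set0 set0I mass0 content0.
  have ms : measurable (cell V s : set (borel X)).
    by apply: measurable_cell => n; exact: open_borel.
  apply: limit_mass_eq; first exact: measurableX.
  apply: pU; exists (size s) => // n /= sn.
  have [_ /(_ s sn B mB) <-] := hT n; congr fine.
  by case: (hp' n) => _ pE _; exact: pE.
have lt_a : ((- a)%:E < plan_cost pi (fun z => - c z)%R)%E.
  by rewrite plan_costN EFinN lteN2.
have Ua := plan_cost_lsc (fun r => lsc_superlevel hX hY r continuous_costN_lsc)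
  UU Uc hpi Upi continuous_costN_class lt_a.
have [q [[_ qa] [n qn]]] : ([set q | couplings mu nu q /\
    ((- a)%:E < plan_cost q (fun z => - c z)%R)%E] `&`
    [set q | exists n, q = p n]) !=set0.
  by apply: (@filter_ex _ U); apply: filterI => //; apply: Up => n; exists n.
exists (T n); first by case: (hT n).
case: (hp' n) => _ _ <-; rewrite -qn.
by move: qa; rewrite plan_costN EFinN lteN2.
Qed.

End continuous_cost.

Theorem proposition2 (R : realType) (X Y : ptopologicalType)
    (hX : polish R X) (hY : polish R Y)
    (mu : probability (borel X) R) (nu : probability (borel Y) R)
    (c : (X * Y) * (X * Y) -> R)
    (hc : cost_class mu nu c)
    (hlsc : lower_semicontinuous (EFin \o c)) :
  (exists pi, minimizer mu nu c pi) /\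
  (atomless mu -> continuous c -> compact [set: X] -> compact [set: Y] ->
   exists2 pi, minimizer mu nu c pi &
     plan_cost pi c =
       ereal_inf [set map_cost (Y := borel Y) mu c T | T in transport_maps mu nu]).
Proof.
have [pi pi_min] := exists_minimizer hX hY hc hlsc.
split; first by exists pi.
move=> mu_atomless cc compX compY; exists pi => //.
have [hpi minpi] := pi_min; have mc := hc.1.
have ic := continuous_cost_integrable mc cc compX compY.
apply/eqP; rewrite eq_le; apply/andP; split.
  apply: le_ereal_inf_tmp => _ [T hT <-].
  have [p pE pc] := graph_plan mu hT.1; rewrite -(pc _ (ic p)).
  by apply: minpi; exact: graph_coupling pE hT.
have fin_pi : plan_cost pi c \is a fin_num by exact: integrable_fin_num (ic pi).
apply/lee_addgt0Pr => e e0; rewrite -(fineK fin_pi) -EFinD.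
have [|T hT cT] := approximate_cost mc cc compX compY hX hY
  (a := fine (plan_cost pi c) + e) mu_atomless hpi.
  by rewrite EFinD fineK// lteDl// lte_fin.
by apply: le_trans (ltW cT); apply: ereal_inf_lbound; exists T.
Qed.
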